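(* Let $d=1$ and let $\mathbb{P}$ be a probability measure on $\Omega=(0,\infty)^{\mathbb{R}\times E_1}$ that is stationary and ergodic with respect to time-space shifts and satisfies $\mathbb{E}[\omega_t(e)]<\infty$ and $\mathbb{E}[\omega_t(e)^{-1}]<\infty$ for all $e\in E_1$ and $t\in\mathbb{R}$. Then the corrector $\chi$ satisfies $$\lim_{n\to\infty}\frac{1}{n^2}\int_0^{n^2}\frac{1}{|B(n)|}\sum_{x\in B(n)}\Big|\frac1n\,\chi(\omega,t,x)\Big|\,dt=0\qquad\mathbb{P}\text{-a.s.},$$ where $B(n)=\{-n,\dots,n\}\subset\mathbb{Z}$ and $|B(n)|$ is its cardinality.
   Context: Environment. $E_1=\{\{x,y\}:x,y\in\mathbb{Z},|x-y|=1\}$; write $x\sim y$ if $\{x,y\}\in E_1$. An element $\omega=\{\omega_t(e):t\in\mathbb{R},e\in E_1\}$ of $\Omega$ is a family of positive time-dependent weights, $\omega_t(x,y)=\omega_t(y,x)=\omega_t(\{x,y\})$ if $\{x,y\}\in E_1$ and $0$ otherwise. $\Omega$ carries its Borel $\sigma$-algebra $\mathcal{F}$; $\mathbb{E}$ is expectation under $\mathbb{P}$. The time-space shift by $(s,z)\in\mathbb{R}\times\mathbb{Z}$ is $(\tau_{s,z}\omega)_t(x,y)=\omega_{t+s}(x+z,y+z)$. Stationary and ergodic means $\mathbb{P}\circ\tau_{t,x}^{-1}=\mathbb{P}$ for all $(t,x)$ and $\mathbb{P}[A]\in\{0,1\}$ for every $A\in\mathcal{F}$ with $\tau_{t,x}(A)=A$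 for all $(t,x)$. For $f:\mathbb{Z}\to\mathbb{R}$, $(\mathcal{L}^\omega_tf)(x)=\sum_{y\sim x}\omega_t(x,y)(f(y)-f(x))$. Function spaces. $L^2_{\mathrm{cov}}$ is the Hilbert space of measurable functions $\Psi:\Omega\times\mathbb{Z}\to\mathbb{R}$ with the cocycle property $\Psi(\tau_{0,x}\omega,y-x)=\Psi(\omega,y)-\Psi(\omega,x)$ for all $x,y\in\mathbb{Z}$, for $\mathbb{P}$-a.e. $\omega$, and $\|\Psi\|^2_{L^2_{\mathrm{cov}}}=\mathbb{E}[\sum_{x\sim0}\omega_0(0,x)|\Psi(\omega,x)|^2]<\infty$. For bounded measurable $\varphi:\Omega\to\mathbb{R}$ let $\mathrm{D}\varphi(\omega,x)=\varphi(\tau_{0,x}\omega)-\varphi(\omega)$. $L^2_{\mathrm{pot}}$ is the closure in $L^2_{\mathrm{cov}}$ of $\{\mathrm{D}\varphi:\varphi\text{ bounded}\}$. The position field is $\Pi(\omega,x)=x$. Corrector. $\Phi_0\in L^2_{\mathrm{cov}}$ denotes the function (known to exist when $\mathbb{P}$ is stationary and ergodic with respect to time-space shifts and satisfies $\mathbb{E}[\omega_t(e)]<\infty$ and $\mathbb{E}[\omega_t(e)^{-1}]<\infty$ for all $e\in E_1$ and $t\in\mathbb{R}$) characterized by: (i) $\chi_0=\Pi-\Phi_0\in L^2_{\mathrm{pot}}$; (ii) the function $\Phi:\Omega\times\mathbb{R}\times\mathbb{Z}\to\mathbb{R}$, $$\Phi(\omega,t,x)=\Phi_0(\tau_{t,0}\omega,x)-\int_0^t\big(\mathcal{L}^\omega_s\Phi_0(\tau_{s,0}\omega,\cdot)\big)(0)\,ds,$$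 satisfies, for $\mathbb{P}$-a.e. $\omega$: $\Phi$ is differentiable for almost every $t\in\mathbb{R}$ with $\partial_t\Phi(\omega,t,x)+\mathcal{L}^\omega_t\Phi(\omega,t,x)=0$, and $\Phi(\omega,0,0)=0$. The corrector is $\chi(\omega,t,x)=x-\Phi(\omega,t,x)$.
   Formalization: Two implicit assumptions are made explicit: (t,ω)↦ω_t(e) is measurable for the completion of dt⊗P, and in (ii) t↦Φ(ω,t,x) is locally absolutely continuous (with a locally integrable integrand), since a.e. differentiability alone does not characterize Φ_0. *)

(* Defs.v *)
From HB Require Import structures.
From mathcomp Require Import all_boot all_order all_algebra.
From mathcomp Require Import all_classical all_reals all_analysis.
From mathcomp Require Import measurable_realfun.

Set Implicit Arguments.
Unset Strict Implicit.
Unset Printing Implicit Defensive.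

Import Order.TTheory GRing.Theory Num.Theory.
Import numFieldNormedType.Exports.

Local Open Scope classical_set_scope.
Local Open Scope ring_scope.

Definition pos_real (R : realType) : Type := set_type [set x : R | 0 < x].

HB.instance Definition _ (R : realType) := Topological.on (pos_real R).

Lemma one_pos_real (R : realType) : (1 : R) \in [set x : R | 0 < x].
Proof. by apply/mem_set => /=; exact: ltr01. Qed.

HB.instance Definition _ (R : realType) :=
  isPointed.Build (pos_real R) (exist _ (1 : R) (one_pos_real R)).

(* An edge {x, x + 1} of Z is coded by its left endpoint x, so the environment
   space (0, oo)^(R x E_1) is the product space (0, oo)^(R x Z). *)
Definition env (R : realType) : Type :=
  prod_topology (fun _ : R * int => pos_real R).

HB.instance Definition _ (R : realType) := Topological.on (env R).
HB.instance Definition _ (R : realType) :=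
  isPointed.Build (env R) (fun _ => point).

Notation Omega R := (g_sigma_algebraType (@open (env R))).

(* The weight at time t of the edge {x, x + 1}. *)
Definition weight (R : realType) (w : Omega R) (t : R) (x : int) : R :=
  \val ((w : R * int -> pos_real R) (t, x)).

Definition conductance (R : realType) (w : Omega R) (t : R) (x y : int) : R :=
  if y == x + 1 then weight w t x
  else if x == y + 1 then weight w t y
  else 0.

Definition nbrs (x : int) : seq int := [:: x - 1; x + 1].

Definition tau (R : realType) (s : R) (z : int) (w : Omega R) : Omega R :=
  (fun tx => (w : R * int -> pos_real R) (tx.1 + s, tx.2 + z)) : env R.

Definition generator (R : realType) (w : Omega R) (t : R) (f : int -> R)
    (x : int) : R :=
  \sum_(y <- nbrs x) conductance w t x y * (f y - f x).

Definition stationary (R : realType) (P : probability (Omega R) R) : Prop :=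
  forall (t : R) (x : int) (A : set (Omega R)), measurable A ->
    P (tau t x @^-1` A) = P A.

(* Events are taken in the P-completion of the Borel sigma-algebra. For Borel A
   the conclusion reads P A = 0 or P A = 1. *)
Definition ergodic (R : realType) (P : probability (Omega R) R) : Prop :=
  forall A : set (Omega R), completed_algebra_gen P A ->
    (forall (t : R) (x : int), tau t x @` A = A) ->
    P.-negligible A \/ P.-negligible (~` A).

(* (t, w) |-> w_t(e) is measurable for the completion of dt (x) P. It is never
   measurable for the uncompleted product sigma-algebra, since R is
   uncountable. *)
Definition jointly_measurable (R : realType) (P : probability (Omega R) R) :
    Prop :=
  forall (x : int) (B : set R), measurable B ->
    completed_algebra_gen (@lebesgue_measure R \x P)%E
      [set p : measurableTypeR R * Omega R | B (weight p.2 p.1 x)].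

Definition finite_moments (R : realType) (P : probability (Omega R) R) : Prop :=
  forall (t : R) (x : int),
    (\int[P]_w (weight w t x)%:E < +oo)%E /\
    (\int[P]_w ((weight w t x)^-1)%:E < +oo)%E.

Definition cocycle (R : realType) (P : probability (Omega R) R)
    (Psi : Omega R -> int -> R) : Prop :=
  {ae P, forall w, forall x y : int,
    Psi (tau 0 x w) (y - x) = Psi w y - Psi w x}.

Definition cov_sqnorm (R : realType) (P : probability (Omega R) R)
    (Psi : Omega R -> int -> R) : \bar R :=
  (\int[P]_w (\sum_(x <- nbrs 0) conductance w 0 0 x * `|Psi w x| ^+ 2)%:E)%E.

Definition L2cov (R : realType) (P : probability (Omega R) R)
    (Psi : Omega R -> int -> R) : Prop :=
  [/\ forall x : int, measurable_fun setT (Psi ^~ x),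
      cocycle P Psi
    & (cov_sqnorm P Psi < +oo)%E].

Definition grad (R : realType) (phi : Omega R -> R) (w : Omega R) (x : int) : R :=
  phi (tau 0 x w) - phi w.

Definition L2pot (R : realType) (P : probability (Omega R) R)
    (Psi : Omega R -> int -> R) : Prop :=
  L2cov P Psi /\
  forall eps : R, 0 < eps ->
    exists phi : Omega R -> R,
      [/\ measurable_fun setT phi,
          exists C : R, forall w, `|phi w| <= C
        & (cov_sqnorm P (fun w x => (Psi w x - grad phi w x)%R) < eps%:E)%E].

Notation leb R := (@completed_lebesgue_measure R).

Definition time_int (R : realType) (f : R -> R) (t : R) : R :=
  if 0 <= t then \int[leb R]_(s in `[0, t]) f s
  else - \int[leb R]_(s in `[t, 0]) f s.

Definition locally_abs_continuous (R : realType) (f : R -> R) : Prop :=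
  forall a b eps : R, 0 < eps ->
    exists2 delta : R, 0 < delta &
      forall (n : nat) (l r : 'I_n -> R),
        (forall i, [/\ a <= l i, l i <= r i & r i <= b]) ->
        trivIset setT (fun i => `]l i, r i[%classic) ->
        \sum_(i < n) (r i - l i) < delta ->
        \sum_(i < n) `|f (r i) - f (l i)| < eps.

Definition drift (R : realType) (Phi0 : Omega R -> int -> R) (w : Omega R)
    (s : R) : R :=
  generator w s (Phi0 (tau s 0 w)) 0.

Definition harm_coord (R : realType) (Phi0 : Omega R -> int -> R) (w : Omega R)
    (t : R) (x : int) : R :=
  Phi0 (tau t 0 w) x - time_int (drift Phi0 w) t.

(* The equation d/dt Phi + L_t Phi = 0 for almost every t is understood, as
   usual, for functions that are locally absolutely continuous in t. *)
Definition solves_backward (R : realType) (w : Omega R)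
    (Phi : R -> int -> R) : Prop :=
  (forall x : int, locally_abs_continuous (Phi ^~ x)) /\
  {ae leb R, forall t, forall x : int,
    derivable (Phi ^~ x) t 1 /\
    derive1 (Phi ^~ x) t + generator w t (Phi t) x = 0}.

Definition is_corrector_field (R : realType) (P : probability (Omega R) R)
    (Phi0 : Omega R -> int -> R) : Prop :=
  [/\ L2cov P Phi0,
      L2pot P (fun w x => x%:~R - Phi0 w x)
    & {ae P, forall w,
        [/\ forall a b : R, (leb R).-integrable `[a, b] (EFin \o drift Phi0 w),
            solves_backward w (harm_coord Phi0 w)
          & harm_coord Phi0 w 0 0 = 0]}].

Definition corrector (R : realType) (Phi0 : Omega R -> int -> R) (w : Omega R)
    (t : R) (x : int) : R :=
  x%:~R - harm_coord Phi0 w t x.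

Definition box (n : nat) : seq int :=
  [seq (k%:Z - n%:Z)%R | k <- iota 0 n.*2.+1].

(* Main.v *)
(* The corrector chi is an additive cocycle in space whose gradient h is
   stationary and integrable, and a time increment of chi is the spatial
   difference of time integrals of the stationary flux j = w_t(x, x+1) Phi_0(x, x+1).
   Compare chi on {-n, ..., n} with its average against a tent function of width
   N = K n. In space, chi differs from that average by boundary terms plus the sum of
   |A_m h|, the average of h over m consecutive edges. In time, the tent
   average changes by at most N^-2 times the sum of the integrals of |j|, since the
   second difference of the tent is that small; over a time n^2 this is O(n / K).
   A weak (1,1) maximal inequality on the boxes [0, n^2) x [-2Kn, 2Kn], with a
   constant that does not depend on K, controls the space-time averages of |h|,
   |j| and |A_m h| uniformly in n, and E|A_m h| -> 0 as m -> oo because h is a limit of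
   gradients of bounded functions. Let n -> oo, then m -> oo and K -> oo. *)

Require Import Defs.
From mathcomp Require Import all_boot all_order all_algebra.
From mathcomp Require Import all_classical all_reals all_analysis.
From mathcomp Require Import measurable_realfun.
From mathcomp Require Import zify ring lra.

Set Implicit Arguments.
Unset Strict Implicit.
Unset Printing Implicit Defensive.

Import Order.TTheory GRing.Theory Num.Theory.
Import numFieldNormedType.Exports.

Local Open Scope classical_set_scope.
Local Open Scope ring_scope.

(** * Completed Lebesgue measure *)

(* The measurable space of Lebesgue-measurable sets, on which [leb R] lives; the
   Borel measurable space on [R] is [measurableTypeR R]. *)
Notation lebT R := (caratheodory_type (@wlength R idfun)^*%mu).

(** The tent cannot be replaced by a sharp window: the flux through the two ends of a window is a
    value at individual sites, which no space average controls. Against the tent, summation by parts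
    leaves fluxes over two blocks of [N] sites.

    The maximal constant must not see [K] because of the order of choice: the level [cj] for the
    flux is fixed first, then [K] large against [cj], then the level [cm] for |A_m h| small against
    1/[K], then [m], and [n] last.

    The tent average at time 0 needs a separate, purely spatial maximal inequality, since space-time
    averages say nothing about a single time; chi(0, 0) = 0 anchors it.

    Two obstacles shape the rest. The flow is not product measurable in time and environment, so
    integrals over unit times are first replaced by measurable functions of the environment with the
    same mean, and the maximal inequality runs over integer times. The equation for Phi holds only
    at almost every time, so increments in time become integrals through a fundamental theorem for
    absolutely continuous functions. *)

Lemma ae_mono d (T : semiRingOfSetsType d) (R : realFieldType)
    (mu : {content set T -> \bar R}) (P Q : T -> Prop) :
  {ae mu, forall w, P w} -> (forall w, P w -> Q w) -> {ae mu, forall w, Q w}.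
Proof. by move=> hP PQ; apply: negligibleS hP => w /=; exact/contra_not/PQ. Qed.

Lemma ae_forall_countable d (T : sigmaRingType d) (R : realFieldType)
    (mu : {measure set T -> \bar R}) (I : countType) (Q : I -> T -> Prop) :
  (forall i, {ae mu, forall w, Q i w}) -> {ae mu, forall w, forall i, Q i w}.
Proof.
move=> h.
pose N k := if unpickle k is Some i then ~` [set w | Q i w] else set0.
have : mu.-negligible (\bigcup_k N k).
  apply: negligible_bigcup => k; rewrite /N.
  by case: unpickle => [i|]; [exact: h | exact: negligible_set0].
apply: negligibleS => w /= /existsNP[i Qi]; exists (pickle i) => //.
by rewrite /N pickleK.
Qed.

(** Superlevel sets at rational levels determine [f]. Each is a measurable set up to a subset of a
    null set, and the countably many null sets fit into one null set [N], on which [f] is replaced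
    by 0. *)
Lemma completed_measurable_version d (T : measurableType d) (R : realType)
    (mu : {measure set T -> \bar R}) (f : T -> R) :
  (forall B : set R, measurable B -> completed_algebra_gen mu (f @^-1` B)) ->
  exists g, measurable_fun setT g /\ {ae mu, forall x, f x = g x}.
Proof.
move=> hf.
have /choice[An hAn] : forall q : rat, exists AN : set T * set T,
    [/\ measurable AN.1, measurable AN.2, mu AN.2 = 0%E,
        AN.1 `<=` [set x | ratr q < f x]
      & [set x | ratr q < f x] `<=` AN.1 `|` AN.2].
  move=> q; have := hf `](ratr q), +oo[%classic (measurable_itv _).
  move=> [A mA [N0 [N [mN N00 N0N]] AN]].
  have fE : [set x | ratr q < f x] = A `|` N0.
    by rewrite AN; apply/seteqP; split => x /=; rewrite in_itv/= andbT.
  exists (A, N); split => //=; rewrite fE; first exact: subsetUl.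
  by move=> x [Ax|/N0N Nx]; [left|right].
have [N [mN N0 AN]] : {ae mu, forall x, forall q, ~ (An q).2 x}.
  apply: ae_forall_countable => q; exists (An q).2.
  by case: (hAn q) => *; split => // x /=; exact: contrapT.
have {}AN q x : (An q).2 x -> N x.
  by move=> Aqx; apply: AN => /= /(_ q).
pose g x := if x \in N then 0 else f x.
exists g; split; last first.
  exists N; split => // x /=; apply: contra_notP => Nx; rewrite /g.
  by rewrite memNset.
apply: (measurability _ (RGenOInfty.measurableE R)) => // _ [_ [r ->] <-].
rewrite setTI.
(* Off [N] the superlevel set is the union of the [(An q).1] with [r < ratr q]; on [N] the value of
   [g] is 0, which exceeds [r] exactly when [r < 0]. *)
have -> : g @^-1` `]r, +oo[%classic =
    (\bigcup_q (if r < ratr q then (An q).1 else set0)) `\` N `|` (if r < 0 then N else set0).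
  apply/seteqP; split => x /=; rewrite in_itv/= andbT /g.
    case: ifPn => [/set_mem xN r0|]; first by right; rewrite r0.
    rewrite notin_setE => xN rfx; left; split => //.
    have [q] := rat_in_itvoo rfx; rewrite in_itv /= => /andP[rq qf].
    exists q; first by [].
    by rewrite rq; case: (hAn q) => _ _ _ _ /(_ x qf)[//|/AN].
  case => [[[q _]]|].
    case: ifPn => // rq Aq xN; rewrite memNset//.
    by apply: lt_trans rq _; case: (hAn q) => _ _ _ + _; exact.
  by case: ifPn => // r0 xN; rewrite mem_set.
apply: measurableU; last by case: ifP.
apply: measurableD => //; apply: countable_bigcupT_measurable => // q.
by case: ifP => // _; case: (hAn q).
Qed.

(** The radius [eta] may depend on [s] with no uniformity: at the supremum of the points satisfying
    [Q], some point just below it carries [Q] beyond it, unless the supremum is [b]. *)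
Lemma real_induction (R : realType) (Q : R -> Prop) (a b : R) : a <= b -> Q a ->
  (forall s, a <= s -> s <= b -> exists2 eta : R, 0 < eta &
     forall c d, a <= c -> c <= s -> s <= d -> d <= b -> s - eta < c -> d < s + eta ->
       Q c -> Q d) ->
  Q b.
Proof.
move=> ab Qa step.
pose S : set R := [set c | [/\ a <= c, c <= b & Q c]].
have Sa : S a by split.
have hS : has_sup S by split; [exists a | exists b => c []].
have aS : a <= sup S by apply: sup_ubound => //; exact: hS.2.
have Sb : sup S <= b by apply: ge_sup => [|c []]; [exists a|].
have [eta eta0 h] := step _ aS Sb.
have [c [ac cb Qc] Sc] := sup_adherent eta0 hS.
have cS : c <= sup S by apply: sup_ubound; [exact: hS.2|split].
pose d := Num.min b (sup S + eta / 2).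
have Sd : sup S <= d by rewrite le_min Sb/= lerDl divr_ge0// ltW.
have db : d <= b by rewrite ge_min lexx.
have d_lt : d < sup S + eta by rewrite gt_min ltrD2l ltr_pdivrMr// mulr2n ltr_pMr// ltrDl ltr01 orbT.
have Qd : Q d by apply: (h c).
have : d <= sup S by apply: sup_ubound; [exact: hS.2|split => //; exact: le_trans aS Sd].
rewrite /d ge_min => /orP[bS|]; last by rewrite gerDl leNgt divr_gt0.
suff -> : b = d by [].
by apply/eqP; rewrite eq_le db andbT (le_trans bS).
Qed.

Lemma locally_abs_continuous_continuous (R : realType) (f : R -> R) :
  locally_abs_continuous f -> continuous f.
Proof.
move=> acf t; apply/cvgrPdist_lt => e e0.
have [d d0 hd] := acf (t - 1) (t + 1) e e0.
near=> y.
have yt : `|t - y| < Num.min 1 d.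
  by near: y; apply: cvgr_dist_lt => //; rewrite lt_min ltr01.
move: yt; rewrite lt_min => /andP[yt1 ytd].
have := hd 1%N (fun=> Num.min t y) (fun=> Num.max t y) _ _ _.
rewrite !big_ord_recl !big_ord0 !addr0.
have mm : Num.max t y - Num.min t y = `|t - y|.
  by rewrite /Num.max /Num.min; case: ltP => h; [rewrite ltr0_norm ?subr_lt0// opprB|rewrite ger0_norm ?subr_ge0].
rewrite mm => /(_ _ _ ytd).
have -> : `|f (Num.max t y) - f (Num.min t y)| = `|f t - f y|.
  by rewrite /Num.max /Num.min; case: ltP => // _; rewrite distrC.
apply.
- move=> _; move: yt1; rewrite ltr_norml => /andP[h1 h2].
  rewrite ge_max le_min; split; [|by rewrite ge_min le_max lexx|];
  by apply/andP; split; lra.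
- by move=> i j _ _ _; rewrite [i]ord1 [j]ord1.
Unshelve. all: by end_near. Qed.

Section lebesgue_completion.
Variable R : realType.
Implicit Types (D N : set R) (f g : R -> R).
Local Notation lambda := (@lebesgue_measure R).

Lemma measurable_leb D :
  measurable (D : set (measurableTypeR R)) -> measurable (D : set (lebT R)).
Proof. exact: sub_caratheodory. Qed.

Lemma measurable_fun_id_leb :
  measurable_fun setT (id : lebT R -> measurableTypeR R).
Proof. by move=> _ A mA; rewrite setTI; exact: measurable_leb. Qed.

Lemma measurable_fun_leb d (T : measurableType d) D (f : R -> T) :
  measurable_fun (D : set (measurableTypeR R)) f -> measurable (D : set (measurableTypeR R)) ->
  measurable_fun (D : set (lebT R)) f.
Proof. by move=> mf mD _ B mB; apply: measurable_leb; exact: mf. Qed.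

Lemma ge0_integral_leb D (f : R -> \bar R) :
  measurable (D : set (measurableTypeR R)) ->
  measurable_fun (D : set (measurableTypeR R)) f ->
  (forall x, D x -> (0 <= f x)%E) ->
  (\int[leb R]_(x in D) f x = \int[lambda]_(x in D) f x)%E.
Proof.
move=> mD mf f0.
have <- := @ge0_integral_pushforward _ _ _ _ _ (id : lebT R -> measurableTypeR R)
  measurable_fun_id_leb (leb R) D f mD mf (fun x h => f0 x (set_mem h)).
apply: (@eq_measure_integral _ (measurableTypeR R) R D lambda) => [|? A mA AD]; first exact: measurable_fun_id_leb.
reflexivity.
Qed.

Lemma leb_measurable_completed D :
  measurable (D : set (lebT R)) -> completed_algebra_gen lambda D.
Proof.
by rewrite -g_sigma_completed_algebra_genE completed_caratheodory_measurable.
Qed.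

Lemma leb_negligible N : (leb R).-negligible N <-> lambda.-negligible N.
Proof.
split => [[A [mA A0 NA]]|[A [mA A0 NA]]]; last first.
  by exists A; split => //; exact: measurable_leb.
have [X mX [Y [Z [mZ Z0 YZ]]] XY] := leb_measurable_completed mA.
apply: (@negligibleS _ (measurableTypeR R) _ lambda A N NA); rewrite -XY; apply: negligibleU; last by exists Z; split.
apply/negligibleP => //; apply/eqP; rewrite -measure_le0 -A0.
have : (leb R X <= leb R (X `|` Y))%E.
  by apply: le_outer_measure; exact: subsetUl.
by rewrite XY.
Qed.

Lemma leb_borel_version f : measurable_fun (setT : set (lebT R)) f ->
  exists g, measurable_fun (setT : set (measurableTypeR R)) g /\
    {ae lambda, forall x, f x = g x}.
Proof.
move=> mf; apply: (@completed_measurable_version _ (measurableTypeR R) R lambda f) => B mB.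
by apply: leb_measurable_completed; rewrite -[X in measurable X]setTI; exact: mf.
Qed.

(** Completeness of [leb R] lets [f] be arbitrary on the exceptional set; time paths of the
    environment are known to be measurable only in this way. *)
Lemma ae_eq_leb_measurable f g : measurable_fun (setT : set (measurableTypeR R)) g ->
  {ae lambda, forall x, f x = g x} -> measurable_fun (setT : set (lebT R)) f.
Proof.
move=> mg fg.
apply/measurable_EFinP.
apply: (@ae_measurable_fun _ (lebT R) R (leb R)
  (@completed_lebesgue_measure_is_complete R) setT (EFin \o g) (EFin \o f)).
- by apply/leb_negligible; apply: negligibleS fg => x /=; apply: contra_not => ->.
- by apply/measurable_EFinP; exact: measurable_fun_leb.
Qed.

End lebesgue_completion.

Lemma ae_eq_integral_leb (R : realType) (f g : R -> R) (D : set R) :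
  measurable_fun (setT : set (measurableTypeR R)) g ->
  {ae @lebesgue_measure R, forall x, f x = g x} ->
  (forall x, 0 <= f x) -> (forall x, 0 <= g x) ->
  measurable (D : set (measurableTypeR R)) ->
  (\int[leb R]_(x in D) (f x)%:E = \int[@lebesgue_measure R]_(x in D) (g x)%:E)%E.
Proof.
move=> mg fg f0 g0 mD.
have mf := ae_eq_leb_measurable mg fg.
have mg' : measurable_fun (D : set (measurableTypeR R)) (EFin \o g).
  by apply/measurable_EFinP; exact: measurable_funS mg.
rewrite -(@ge0_integral_leb R D (EFin \o g)) //; last by move=> x _; rewrite lee_fin.
apply: (@ge0_ae_eq_integral _ (lebT R) R (leb R) D (EFin \o f) (EFin \o g)).
- exact: measurable_leb.
- by apply/measurable_EFinP; apply: measurable_funS mf.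
- exact: measurable_fun_leb.
- by move=> x _; rewrite lee_fin.
- by move=> x _; rewrite lee_fin.
- by apply/leb_negligible; apply: negligibleS fg => x /= + fgx; apply => _; rewrite /= fgx.
Qed.

Section translation.
Variable R : realType.
Local Notation lambda := (@lebesgue_measure R).

Lemma measurable_fun_addr (k : R) :
  measurable_fun setT ((fun s : R => s + k) : measurableTypeR R -> measurableTypeR R).
Proof.
by apply: measurable_funD => //; exact: measurable_id.
Qed.

Lemma lebesgue_measure_addr (k : R) (A : set (measurableTypeR R)) : measurable A ->
  lambda ((fun s : R => s + k) @^-1` A) = lambda A.
Proof.
move=> mA; apply/esym.
apply: (@lebesgue_measure_unique R (pushforward lambda ((fun s : R => s + k) :
  measurableTypeR R -> measurableTypeR R))) => //; first exact: measurable_fun_addr.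
move=> ? X [[a b] _ <-] /=; rewrite /pushforward.
have -> : (fun s : R => s + k) @^-1` `]a, b] = `]a - k, b - k]%classic.
  by apply/seteqP; split => x /=; rewrite !in_itv/= ltrBlDr lerBrDr.
rewrite !lebesgue_measure_itv/= !lte_fin ltrD2r.
by case: ifP => // _; rewrite -!EFinB; congr (_%:E); ring.
Qed.

Lemma ge0_integral_addr (k : R) (g : R -> R) :
  measurable_fun (setT : set (measurableTypeR R)) g -> (forall x, 0 <= g x) ->
  (\int[lambda]_(s in `[0%R, 1%R]) (g (s + k))%:E = \int[lambda]_(s in `[k, (k + 1)%R]) (g s)%:E)%E.
Proof.
move=> mg g0.
have := @ge0_integral_pushforward _ _ (measurableTypeR R) (measurableTypeR R) R
  (fun s => s + k) (measurable_fun_addr k) lambda `[k, k + 1]%classic (EFin \o g).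
move=> /(_ (measurable_itv _)) h.
have -> : `[0%R, 1%R]%classic = (fun s : R => s + k) @^-1` `[k, k + 1].
  by apply/seteqP; split => x /=; rewrite !in_itv/= lerDr addrC lerD2l.
rewrite -h.
- apply: eq_measure_integral => [|? A mA AD]; first exact: measurable_fun_addr.
  exact: lebesgue_measure_addr.
- by apply/measurable_EFinP; exact: measurable_funS mg.
- by move=> x _; rewrite lee_fin.
Qed.

Lemma ae_addr (k : R) (Q : R -> Prop) : {ae lambda, forall s, Q s} ->
  {ae lambda, forall s, Q (s + k)}.
Proof.
move=> [A [mA A0 QA]]; exists ((fun s : R => s + k) @^-1` A); split.
- by rewrite -[X in measurable X]setTI; exact: measurable_fun_addr.
- by rewrite lebesgue_measure_addr.
- by move=> s /= Qs; exact: QA.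
Qed.

End translation.

(** * Space-time shifts *)

Lemma continuous_to_product (X : topologicalType) (I : Type)
    (K : I -> topologicalType) (f : X -> prod_topology K) :
  (forall i, continuous (fun x => f x i)) -> continuous f.
Proof.
move=> cf x; apply/cvg_sup => i U [W [[V oV <-] /= Vfx]] /filterS; apply.
by apply: cf; exact: open_nbhs_nbhs.
Qed.

Section shift.
Variable R : realType.
Implicit Types (s t : R) (x y : int) (w : Omega R).

Lemma tau_tau s t x y w : tau s x (tau t y w) = tau (t + s) (y + x) w.
Proof.
by apply/funext => -[a b]; rewrite /tau/= -!addrA [s + t]addrC [x + y]addrC.
Qed.

Lemma tau00 w : tau 0 0 w = w.
Proof. by apply/funext => -[a b]; rewrite /tau/= !addr0. Qed.

Lemma weight_tau s t x y w : weight (tau s x w) t y = weight w (t + s) (y + x).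
Proof. by []. Qed.

Lemma continuous_tau s x : continuous (tau s x : env R -> env R).
Proof.
apply: (@continuous_to_product (env R) _ (fun _ : R * int => pos_real R)) => i.
exact: (@proj_continuous _ (fun _ : R * int => pos_real R) (i.1 + s, i.2 + x)).
Qed.

Lemma measurable_tau s x : measurable_fun setT (tau s x : Omega R -> Omega R).
Proof.
apply: (@measurability _ _ (Omega R) (Omega R) setT (tau s x) (@open (env R)) erefl).
move=> _ [U oU <-]; rewrite setTI; apply: sub_sigma_algebra => /=.
by move: oU; apply: open_comp => w _; exact: continuous_tau.
Qed.

Variable P : probability (Omega R) R.
Hypothesis P_stationary : stationary P.

Lemma integral_tau s x (f : Omega R -> \bar R) : measurable_fun setT f ->
  (forall w, 0 <= f w)%E -> (\int[P]_w f (tau s x w) = \int[P]_w f w)%E.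
Proof.
move=> mf f0.
have <- := @ge0_integral_pushforward _ _ _ _ _ (tau s x) (measurable_tau s x) P setT f
  measurableT mf (fun w _ => f0 w).
by apply: eq_measure_integral => [|? A mA _]; [exact: measurable_tau | exact: P_stationary].
Qed.

Lemma negligible_tau s x (N : set (Omega R)) : P.-negligible N ->
  P.-negligible (tau s x @^-1` N).
Proof.
move=> [A [mA A0 NA]]; exists (tau s x @^-1` A); split.
- by rewrite -[X in measurable X]setTI; exact: measurable_tau.
- by rewrite P_stationary.
- by move=> w /=; exact: NA.
Qed.

Lemma ae_tau s x (Q : Omega R -> Prop) : {ae P, forall w, Q w} ->
  {ae P, forall w, Q (tau s x w)}.
Proof. exact: negligible_tau. Qed.

End shift.

(** * A maximal inequality for space-time boxes *)

(* [B z] is the box at [z] and [D z] its enlargement; a maximal level is chosen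
   greedily. *)
Lemma finite_vitali_covering (R : realType) (T : finType) (S : {set T})
    (level : T -> nat) (B D : T -> {set T}) (c : R) (f : T -> \bar R) :
  0 <= c -> (forall u, 0 <= f u)%E ->
  (forall z, z \in S -> z \in D z) ->
  (forall z z', z \in S -> z' \in S -> (level z' <= level z)%N ->
    ~~ [disjoint B z & B z'] -> z' \in D z) ->
  (forall z, z \in S -> ((c * #|D z|%:R)%:E <= \sum_(u in B z) f u)%E) ->
  ((c * #|S|%:R)%:E <= \sum_(u in (\bigcup_(z in S) B z)%SET) f u)%E.
Proof.
move=> c0 f0; have [n] := ubnP #|S|; elim: n S => // n IH S.
rewrite ltnS => Sn SD hD hB.
have [->|[z1 z1S]] := set_0Vmem S.
  by rewrite finset.cards0 mulr0; apply: sume_ge0.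
pose z0 := [arg max_(z > z1 in S) level z]%N.
have [z0S z0max] : z0 \in S /\ forall z, z \in S -> (level z <= level z0)%N.
  by rewrite /z0; case: arg_maxnP.
(* The points discarded here lie in [D z0] by maximality of the level of [z0], so the sum over
   [B z0] pays for them; the boxes kept are disjoint from [B z0]. *)
pose S' := [set z in S | (z != z0) && [disjoint B z0 & B z]]%SET.
have S'S : S' \subset S by apply/fintype.subsetP => z; rewrite inE => /andP[].
have S'D z : z \in S -> z \notin S' -> z \in D z0.
  move=> zS; rewrite inE zS /= negb_and negbK => /orP[/eqP ->|nd]; first exact: SD.
  by apply: hD => //; exact: z0max.
have cS' : (#|S'| < n)%N.
  apply: leq_trans Sn; apply: proper_card; apply/properP; split => //.
  by exists z0 => //; rewrite inE eqxx andbF.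
have mS' z : z \in S' -> z \in S by move/(fintype.subsetP S'S).
have := IH S' cS' (fun z h => SD z (mS' z h))
  (fun z z' h h' => hD z z' (mS' z h) (mS' z' h')) (fun z h => hB z (mS' z h)).
move=> IH'.
have cS : (#|S| <= #|D z0| + #|S'|)%N.
  apply: leq_trans (leq_card_setU _ _).
  apply/subset_leq_card/fintype.subsetP => z zS; rewrite finset.in_setU.
  by case: (boolP (z \in S')) => [|/(S'D _ zS)->]; rewrite ?orbT.
have dis : [disjoint B z0 & (\bigcup_(z in S') B z)%SET]%B.
  by apply/bigcup_disjointP => z; rewrite inE => /and3P[].
have sub : (B z0 :|: \bigcup_(z in S') B z \subset \bigcup_(z in S) B z)%SET.
  rewrite finset.subUset; apply/andP; split; first exact: (finset.bigcup_sup z0).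
  apply/fintype.subsetP => u /finset.bigcupP[z /mS' zS uz].
  by apply/finset.bigcupP; exists z.
set U := (\bigcup_(z in S') B z)%SET in IH' dis sub *.
set V := (\bigcup_(z in S) B z)%SET in sub *.
have UE : (\sum_(u in (B z0 :|: U)%SET) f u = \sum_(u in B z0) f u + \sum_(u in U) f u)%E.
  by rewrite -bigU//=; apply: eq_bigl => u; rewrite finset.in_setU.
apply: (@le_trans _ _ (\sum_(u in (B z0 :|: U)%SET) f u)%E).
  rewrite UE; apply: le_trans (leeD (hB _ z0S) IH').
  by rewrite -EFinD lee_fin -mulrDr -natrD ler_wpM2l// ler_nat.
rewrite [leRHS](bigID (mem (B z0 :|: U)%SET))/=.
apply: le_trans (leeDl _ _); last by apply: sume_ge0 => *; exact: f0.
rewrite le_eqVlt; apply/orP; left; apply/eqP.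
by apply: eq_bigl => u; apply/idP/andP => [h|[]//]; split=> //; exact: (fintype.subsetP sub).
Qed.

Section maximal_inequality.
Variables (R : realType) (P : probability (Omega R) R).
Hypothesis P_stationary : stationary P.
Variables (F : Omega R -> \bar R) (a b : nat -> nat).
Hypotheses (mF : measurable_fun setT F) (F0 : forall w, (0 <= F w)%E).

Definition box_sum n (w : Omega R) : \bar R :=
  (\sum_(i < a n) \sum_(y < (b n).*2.+1) F (tau i%:R (y%:Z - (b n)%:Z) w))%E.

Hypotheses (a_gt0 : forall n, (0 < a n)%N).
Hypotheses (a_homo : {homo a : m n / (m <= n)%N}).
Hypotheses (b_homo : {homo b : m n / (m <= n)%N}).
Variables (c : R).
Hypothesis c0 : 0 < c.

Definition exceeds n : set (Omega R) :=
  [set w | ((c * (a n * (b n).*2.+1)%:R)%:E < box_sum n w)%E].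

Lemma measurable_box_sum n : measurable_fun setT (box_sum n).
Proof.
apply: emeasurable_sum => i; apply: emeasurable_sum => y.
exact: measurableT_comp (measurable_tau _ _).
Qed.

Lemma measurable_exceeds n : measurable (exceeds n).
Proof.
rewrite -[X in measurable X]setTI.
by apply: emeasurable_fun_o_infty => //; exact: measurable_box_sum.
Qed.

Section finite.
Variable N : nat.
Let A := a N.
Let B := b N.
(** The window [T] has [2 A] times and [4 B + 1] places, with the origin at place [2 B]. Boxes of
    level at most [N] based in [sites] (times below [A], places from [B] to [3 B]) stay inside it,
    so [inord] never falls back to its default on them. *)
Let m := (A + A).-1.
Let l := (4 * B)%N.
Let T := ('I_m.+1 * 'I_l.+1)%type.
Let shift (z : T) (w : Omega R) := tau z.1%:R (z.2%:Z - (2 * B)%N%:Z) w.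

Let cell_point n (z : T) (u : 'I_(a n) * 'I_(b n).*2.+1) : T :=
  (inord (z.1 + u.1), inord (z.2 + u.2 - b n)).
Let cell n (z : T) : {set T} := (@cell_point n z @: [set: 'I_(a n) * 'I_(b n).*2.+1])%SET.
(** Two boxes of levels [n' <= n] that meet have base points less than [a n] apart in time and at
    most [2 * b n] apart in space. The resulting hull has at most four times the size of the box,
    whatever the shape of the box. *)
Let hull_point n (z : T) (u : 'I_((a n).*2) * 'I_(4 * b n).+1) : T :=
  (inord (z.1 + u.1 - a n), inord (z.2 + u.2 - (b n).*2)).
Let hull n (z : T) : {set T} := (@hull_point n z @: [set: 'I_((a n).*2) * 'I_(4 * b n).+1])%SET.
Let site_point (u : 'I_A * 'I_B.*2.+1) : T := (inord u.1, inord (B + u.2)).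
Let sites : {set T} := (site_point @: [set: 'I_A * 'I_B.*2.+1])%SET.

Let sitesP z : z \in sites -> [/\ (z.1 < A)%N, (B <= z.2)%N & (z.2 <= 3 * B)%N].
Proof.
move=> /imsetP[[i y] _ ->] /=.
have mE : m = (A + A).-1 by []; have lE : l = (4 * B)%N by [].
have := ltn_ord i; have := ltn_ord y => hy hi.
rewrite !inordK; try lia; split; lia.
Qed.

Let card_sites : #|sites| = (A * B.*2.+1)%N.
Proof.
rewrite card_imset ?cardsT ?card_prod ?card_ord//.
move=> [i y] [i' y'] /= [] /(congr1 val) /= + /(congr1 val) /=.
have := ltn_ord i; have := ltn_ord i'; have := ltn_ord y; have := ltn_ord y'.
have mE : m = (A + A).-1 by []; have lE : l = (4 * B)%N by [].
move=> h1 h2 h3 h4; rewrite !inordK; try lia.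
by move=> h5 h6; congr (_, _); apply: val_inj => /=; lia.
Qed.

Let box_sumE n z w : (n <= N)%N -> z \in sites ->
  box_sum n (shift z w) = (\sum_(u in cell n z) F (shift u w))%E.
Proof.
case: z => zi zy nN /sitesP[/= zA Bz zB].
have an : (a n <= A)%N by exact: a_homo.
have bn : (b n <= B)%N by exact: b_homo.
rewrite /box_sum pair_big /= big_imset/=; last first.
  move=> [i y] [i' y'] _ _ /= [] /(congr1 val) /= + /(congr1 val) /=.
  have := ltn_ord i; have := ltn_ord i'; have := ltn_ord y; have := ltn_ord y'.
  have mE : m = (A + A).-1 by []; have lE : l = (4 * B)%N by [].
move=> h1 h2 h3 h4; rewrite !inordK; try lia.
  by move=> h5 h6; congr (_, _); apply: val_inj => /=; lia.
apply: eq_big => [u|[i y] _]; first by rewrite finset.in_setT.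
rewrite /shift tau_tau /=.
have := ltn_ord i; have := ltn_ord y => hy hi.
have mE : m = (A + A).-1 by []; have lE : l = (4 * B)%N by [].
rewrite !inordK; try lia.
by congr (F (tau _ _ w)); [rewrite natrD | lia].
Qed.

Let card_hull n z : (#|hull n z| <= 4 * (a n * (b n).*2.+1))%N.
Proof.
apply: leq_trans (leq_imset_card _ _) _.
rewrite cardsT card_prod !card_ord; nia.
Qed.

Let hullP n n' z z' : (n' <= n)%N -> (n <= N)%N -> z \in sites -> z' \in sites ->
  ~~ [disjoint cell n z & cell n' z']%B -> z' \in hull n z.
Proof.
case: z => zi zy; case: z' => zi' zy'.
move=> n'n nN /sitesP[/= zA Bz zB] /sitesP[/= zA' Bz' zB'] /pred0Pn[u /=].
have an : (a n <= A)%N by exact: a_homo.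
have bn : (b n <= B)%N by exact: b_homo.
have an' : (a n' <= a n)%N by exact: a_homo.
have bn' : (b n' <= b n)%N by exact: b_homo.
move=> /andP[/imsetP[[i y] _ ->] /imsetP[[i' y'] _]] /=.
have := ltn_ord i; have := ltn_ord i'; have := ltn_ord y; have := ltn_ord y'.
have mE : m = (A + A).-1 by []; have lE : l = (4 * B)%N by [].
move=> h1 h2 h3 h4 [] /(congr1 val) /= + /(congr1 val) /=.
rewrite !inordK; try lia.
move=> h5 h6.
have ha : (zi' + a n - zi < (a n).*2)%N by lia.
have hb : (zy' + (b n).*2 - zy < (4 * b n).+1)%N by lia.
apply/imsetP; exists (Ordinal ha, Ordinal hb); first by rewrite finset.in_setT.
rewrite /hull_point; apply/eqP; rewrite xpair_eqE/= -!val_eqE/=.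
by rewrite !inordK; try lia; apply/andP; split; lia.
Qed.

Let EN := \bigcup_(n in `I_N.+1) exceeds n.

Let mEN : measurable EN.
Proof. by apply: bigcup_measurable => n _; exact: measurable_exceeds. Qed.

(** The weak (1,1) bound for one fixed environment, by the covering lemma: every point of [sites]
    that exceeds [c] at some level has a box sum above [c] times the size of its box, hence at least
    [c / 4] times the size of its hull. *)
Let count_le w :
  ((c / 4 * (\sum_(z <- enum sites) \1_EN (shift z w)))%:E <= \sum_(u : T) F (shift u w))%E.
Proof.
pose hit z n := `[< exceeds n (shift z w) >].
(* The default [ord0] is never met on [S], whose points exceed at some level at most [N]. *)
pose level z := odflt ord0 [pick n : 'I_N.+1 | hit z n].
pose S := [set z in sites | `[< EN (shift z w) >]]%SET.
have levelP z : z \in S -> exceeds (level z) (shift z w).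
  rewrite inE => /andP[_ /asboolP[n /= nN hn]]; rewrite /level.
  case: pickP => [k /asboolP//|/(_ (Ordinal nN))/asboolP]; exact.
have Ss z : z \in S -> z \in sites by rewrite inE => /andP[].
have lN z : (level z <= N)%N by rewrite -ltnS.
have -> : \sum_(z <- enum sites) \1_EN (shift z w) = #|S|%:R :> R.
  rewrite big_enum/=.
  rewrite -sum1_card natr_sum [RHS](eq_bigl (fun z => (z \in sites) && `[< EN (shift z w) >])); last first.
    by move=> z; rewrite inE.
  rewrite big_mkcondr/=; apply: eq_bigr => z _; rewrite indicE.
  by case: asboolP => h; [rewrite mem_set|rewrite memNset].
apply: le_trans (@finite_vitali_covering _ T S level (fun z => cell (level z) z)
  (fun z => hull (level z) z) (c / 4) (fun u => F (shift u w)) _ _ _ _ _) _.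
- by rewrite divr_ge0// ltW.
- by move=> u; exact: F0.
- move=> z /Ss zs; apply: (hullP (leqnn _)) => //.
  have := box_sumE w (lN z) zs => bs.
  apply/pred0Pn => /=.
  have an := a_gt0 (level z).
  exists (inord (z.1 + Ordinal an), inord (z.2 + (ord0 : 'I_(b (level z)).*2.+1) - b (level z))).
  by rewrite andbb; apply/imsetP; exists (Ordinal an, ord0); rewrite ?finset.in_setT.
- by move=> z z' /Ss zs /Ss zs' ll; exact: hullP.
- move=> z zS; rewrite -box_sumE ?Ss//; apply: le_trans (ltW (levelP _ zS)).
  rewrite lee_fin -mulrA ler_pM2l// ler_pdivrMl//.
  by rewrite -natrM ler_nat card_hull.
rewrite [leRHS](bigID (mem (\bigcup_(z in S) cell (level z) z)%SET))/=.
by apply: leeDl; apply: sume_ge0 => u _; exact: F0.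
Qed.

(** Integrating [count_le], stationarity makes all terms on either side equal, so only the ratio of
    [#|T|] to [#|sites|] remains. It is at most 4, which with the 4 of the hulls gives 16,
    independently of [N] and of the shape of the boxes. *)
Lemma finite_maximal_inequality : ((c / 16)%:E * P EN <= \int[P]_w F w)%E.
Proof.
have mF' z : measurable_fun setT (fun w => F (shift z w)).
  exact: measurableT_comp (measurable_tau _ _).
have : (\int[P]_w (c / 4 * (\sum_(z <- enum sites) \1_EN (shift z w)))%:E <=
        \int[P]_w \sum_(u : T) F (shift u w))%E.
  apply: ge0_le_integral => //.
  - move=> w _; rewrite lee_fin; apply: mulr_ge0; first by rewrite divr_ge0// ltW.
    by apply: sumr_ge0 => z _; rewrite indicE.
  - apply/measurable_EFinP; apply: measurable_funM => //.
    apply: measurable_sum => z.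
    exact: measurableT_comp (measurable_indic mEN) (measurable_tau _ _).
  - exact: emeasurable_sum.
rewrite ge0_integral_sum//.
rewrite (eq_bigr (fun=> \int[P]_w F w)%E); last first.
  by move=> u _; rewrite (integral_tau P_stationary).
have -> : (\int[P]_w (c / 4 * (\sum_(z <- enum sites) \1_EN (shift z w)))%:E =
    (c / 4 * #|sites|%:R)%:E * P EN)%E.
  under eq_integral do rewrite EFinM.
  rewrite ge0_integralZl//=; last 3 first.
  - apply/measurable_EFinP/measurable_sum => z.
    exact: measurableT_comp (measurable_indic mEN) (measurable_tau _ _).
  - by move=> w _; rewrite lee_fin; apply: sumr_ge0 => z _; rewrite indicE.
  - by rewrite lee_fin divr_ge0// ltW.
  rewrite [in RHS]EFinM -muleA; congr (_ * _)%E.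
  under eq_integral do rewrite -sumEFin.
  have mS z : measurable_fun setT (fun w => (\1_EN (shift z w))%:E : \bar R).
    apply/measurable_EFinP.
    exact: measurableT_comp (measurable_indic mEN) (measurable_tau _ _).
  rewrite ge0_integral_sum//.
  rewrite (eq_bigr (fun=> P EN)).
    rewrite -[P EN]fineK ?fin_num_measure// sumEFin big_enum/= sumr_const.
    by rewrite -EFinM mulr_natl.
  move=> z _.
  rewrite (@integral_tau _ P P_stationary _ _ (fun w => (\1_EN w)%:E))//.
  - by rewrite integral_indic// setIT.
  - by apply/measurable_EFinP; exact: measurable_indic.
have [->|Fy] := eqVneq (\int[P]_w F w)%E +oo%E; first by rewrite leey.
have -> : (\int[P]_w F w = (fine (\int[P]_w F w))%:E)%E.
  rewrite fineK// ge0_fin_numE ?lt_neqAle ?Fy ?leey//.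
  by apply: integral_ge0 => w _; exact: F0.
have -> : (P EN = (fine (P EN))%:E)%E by rewrite fineK// fin_num_measure.
set e := fine (\int[P]_w F w)%E; set p := fine (P EN).
have e0 : 0 <= e by apply: fine_ge0; apply: integral_ge0 => w _; exact: F0.
rewrite sumEFin sumr_const -!EFinM !lee_fin card_sites.
have := a_gt0 N; rewrite -/A => A0.
have cT : (#|[set: T]%SET| <= 4 * (A * B.*2.+1))%N.
  rewrite cardsT card_prod !card_ord /m /l; nia.
rewrite -[e *+ _]mulr_natl => h.
have q0 : 0 < (A * B.*2.+1)%:R :> R by rewrite ltr0n muln_gt0 A0.
rewrite -(ler_pM2l q0); apply: (@le_trans _ _ (4^-1 * (c / 4 * (A * B.*2.+1)%:R * p))).
  by rewrite le_eqVlt; apply/orP; left; apply/eqP; field.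
rewrite ler_pdivrMl//; apply: (le_trans h); rewrite mulrA -natrM.
by apply: ler_wpM2r => //; rewrite ler_nat -cardsT.
Qed.

End finite.

Lemma maximal_inequality :
  measurable (\bigcup_n exceeds n) /\
  ((c / 16)%:E * P (\bigcup_n exceeds n) <= \int[P]_w F w)%E.
Proof.
split; first by apply: bigcupT_measurable; exact: measurable_exceeds.
pose E N := \bigcup_(n in `I_N.+1) exceeds n.
have -> : \bigcup_n exceeds n = \bigcup_N E N.
  apply/seteqP; split => [w [n _ hn]|w [N _ [n _ hn]]]; last by exists n.
  by exists n => //; exists n => //=.
have mE N : measurable (E N).
  by apply: bigcup_measurable => n _; exact: measurable_exceeds.
have cv : P \o E @ \oo --> P (\bigcup_N E N).
  apply: nondecreasing_cvg_mu => //; first exact: bigcupT_measurable.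
  move=> M N MN; apply/subsetPset; apply: bigcup_subset => n /=.
  by move=> /leq_trans; apply.
have cv' : ((c / 16)%:E * P (E N))%E @[N --> \oo] --> ((c / 16)%:E * P (\bigcup_N E N))%E.
  by apply: cvgeZl => //.
apply: (cvge_le _ cv'); apply: nearW => N; exact: finite_maximal_inequality.
Qed.
End maximal_inequality.

(** * Tent averages of sequences *)

Lemma norm_sum_shift_le (R : realType) (d : nat -> R) (m L M s : nat) :
  (s + L + m <= M)%N ->
  \sum_(p < L) \sum_(k < m) `|d (s + p + k)%N| <= m%:R * \sum_(p < M) `|d p|.
Proof.
move=> sLM; rewrite exchange_big /=.
rewrite (_ : m%:R = \sum_(k < m) (1 : R)); last by rewrite sumr_const card_ord.
rewrite mulr_suml.
apply: ler_sum => k _; rewrite mul1r.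
have -> : \sum_(p < L) `|d (s + p + k)%N| = \sum_(s + k <= p < s + k + L) `|d p|.
  rewrite -{1}[(s + k)%N]add0n big_addn addKn big_mkord; apply: eq_bigr => i _.
  by congr (`|d _|); lia.
rewrite -(big_mkord xpredT (fun p => `|d p|)).
have h1 : (s + k <= M)%N by have := ltn_ord k; lia.
have h2 : (s + k + L <= M)%N by have := ltn_ord k; lia.
rewrite (big_cat_nat (leq0n _) h1) /= (big_cat_nat _ h2) /=; last lia.
by rewrite addrCA lerDl addr_ge0// sumr_ge0.
Qed.

Section flatness.
Variables (R : realType) (c : nat -> R) (m : nat).
Hypothesis m0 : (0 < m)%N.
Let d p := c p.+1 - c p.
Let dm p := m%:R^-1 * \sum_(k < m) d (p + k)%N.
Let cm p := m%:R^-1 * \sum_(k < m) c (p + k)%N.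

Lemma norm_sub_average_le p : `|c p - cm p| <= \sum_(k < m) `|d (p + k)%N|.
Proof.
have -> : c p - cm p = m%:R^-1 * \sum_(k < m) (c p - c (p + k)%N).
  rewrite sumrB mulrBr sumr_const card_ord -[c p *+ m]mulr_natl mulKf//.
  by rewrite pnatr_eq0 -lt0n.
rewrite normrM ger0_norm ?invr_ge0// ler_pdivrMl ?ltr0n//.
apply: le_trans (ler_norm_sum _ _ _) _.
rewrite (_ : m%:R = \sum_(k < m) (1 : R)); last by rewrite sumr_const card_ord.
rewrite mulr_suml.
apply: ler_sum => k _; rewrite mul1r distrC.
have -> : c (p + k)%N - c p = \sum_(i < k) d (p + i)%N.
  elim: (val k) => [|j IH]; first by rewrite big_ord0 addn0 subrr.
  by rewrite big_ord_recr/= -IH /d addnS; ring.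
apply: le_trans (ler_norm_sum _ _ _) _.
rewrite -!(big_mkord xpredT (fun i => `|d (p + i)%N|)).
by rewrite [leRHS](big_cat_nat (leq0n _) (ltnW (ltn_ord k)))/= lerDl sumr_ge0.
Qed.

(** Smoothing over [m] sites turns the increments [d] into their averages [dm]; this is how the
    cancellation in A_m h enters. *)
Lemma average_increment p : cm p.+1 - cm p = dm p.
Proof.
by rewrite /cm -mulrBr -sumrB.
Qed.

Let average_flat_le p q M : (p <= q <= M)%N ->
  `|cm q - cm p| <= \sum_(z < M) `|dm z|.
Proof.
move=> /andP[pq qM].
have -> : cm q - cm p = \sum_(p <= z < q) dm z.
  by rewrite -(telescope_sumr _ pq)//; apply: eq_bigr => z _; rewrite average_increment.
apply: le_trans (ler_norm_sum _ _ _) _.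
rewrite -(big_mkord xpredT (fun z => `|dm z|)) (big_cat_nat (leq0n _) qM)/=.
by rewrite (big_cat_nat (leq0n _) pq)/= addrAC lerDr addr_ge0// sumr_ge0.
Qed.

(** The comparison passes through the smoothed sequence [cm]. The uncancelled increments [d] are
    paid only over [m] edges at each end; the long way from [p] to [q] costs the averaged increments
    [dm]. *)
Lemma flat_le p q M : (p <= M)%N -> (q <= M)%N ->
  `|c p - c q| <= \sum_(k < m) `|d (p + k)%N| + \sum_(k < m) `|d (q + k)%N|
     + \sum_(z < M) `|dm z|.
Proof.
move=> pM qM.
have -> : c p - c q = (c p - cm p) - (c q - cm q) + (cm p - cm q) by ring.
apply: le_trans (ler_normD _ _) _; apply: lerD.
  by apply: le_trans (ler_normB _ _) _; apply: lerD; exact: norm_sub_average_le.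
by case/orP: (leq_total p q) => h; [rewrite distrC|];
  apply: average_flat_le; rewrite h.
Qed.

(* The average of [c] against a tent supported in [[N, 3 N]], written as a double box
   average; the origin of space corresponds to index [2 * N]. *)
Definition tent_average (N : nat) :=
  (N%:R ^+ 2)^-1 * \sum_(a < N) \sum_(i < N) c (2 * N + i - a)%N.

(** The tent weights have mass one, so the difference is an average of [c p - c q]. Summed over [N]
    consecutive [q], the local error at [q] counts each edge at most [m] times, whence the factor
    [m / N]. *)
Lemma sub_tent_average_le N p : (0 < N)%N -> (m <= N)%N -> (p <= 4 * N)%N ->
  `|c p - tent_average N| <= \sum_(k < m) `|d (p + k)%N|
     + m%:R / N%:R * (\sum_(z < (4 * N).+1) `|d z|)
     + \sum_(z < (4 * N).+1) `|dm z|.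
Proof.
move=> N0 mN pN.
have N0' : N%:R != 0 :> R by rewrite pnatr_eq0 -lt0n.
have NN0 : 0 < (N%:R ^+ 2)^-1 :> R by rewrite invr_gt0 exprn_gt0// ltr0n.
have cst (e : R) : e = (N%:R ^+ 2)^-1 * \sum_(a < N) \sum_(i < N) e.
  by rewrite !sumr_const !card_ord -mulrnA -[_ *+ (N * N)]mulr_natl natrM -expr2 mulKf// expf_neq0.
have -> : c p - tent_average N = (N%:R ^+ 2)^-1 *
    \sum_(a < N) \sum_(i < N) (c p - c (2 * N + i - a)%N).
  rewrite {1}(cst (c p)) -mulrBr -sumrB; congr (_ * _); apply: eq_bigr => a _.
  by rewrite sumrB.
rewrite normrM ger0_norm ?(ltW NN0)//.
set B := \sum_(k < m) _; set Sd := \sum_(z < _) `|d z|; set Sm := \sum_(z < _) `|dm z|.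
have -> : B + m%:R / N%:R * Sd + Sm =
   (N%:R ^+ 2)^-1 * (\sum_(a < N) (N%:R * B + m%:R * Sd + N%:R * Sm)).
  by rewrite sumr_const card_ord -[(_ + _ + _) *+ N]mulr_natl; field.
rewrite ler_pM2l//; apply: le_trans (ler_norm_sum _ _ _) _.
apply: ler_sum => a _; apply: le_trans (ler_norm_sum _ _ _) _.
have aN := ltn_ord a.
apply: (@le_trans _ _ (\sum_(i < N) (B + \sum_(k < m) `|d (2 * N + i - a + k)%N| + Sm))).
  apply: ler_sum => i _; apply: flat_le; first by lia.
  by have := ltn_ord i; lia.
rewrite !big_split/= !sumr_const !card_ord -[B *+ N]mulr_natl -[Sm *+ N]mulr_natl.
rewrite lerD2r lerD2l.
apply: le_trans (@norm_sum_shift_le _ d m N (4 * N).+1 (2 * N - a) _); last by lia.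
rewrite le_eqVlt; apply/orP; left; apply/eqP; apply: eq_bigr => i _.
by apply: eq_bigr => k _; congr (`|d _|); lia.
Qed.

(** The local error at [p] is averaged over the [2 n + 1] sites as it was over the tent and
    contributes at most [m / n]; with [m / N <= m / n] this makes the factor 2. *)
Lemma box_average_le N n : (0 < n)%N -> (n <= N)%N -> (m <= N)%N ->
  (n.*2.+1)%:R^-1 * \sum_(k < n.*2.+1) `|c (2 * N - n + k)%N| <=
  2 * (m%:R / n%:R) * (\sum_(z < (4 * N).+1) `|d z|)
     + \sum_(z < (4 * N).+1) `|dm z| + `|tent_average N|.
Proof.
move=> n0 nN mN.
have N0 : (0 < N)%N by lia.
rewrite ler_pdivrMl ?ltr0n//.
set Sd := \sum_(z < _) `|d z|; set Sm := \sum_(z < _) `|dm z|.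
have Sd0 : 0 <= Sd by exact: sumr_ge0.
apply: (@le_trans _ _ (\sum_(k < n.*2.+1) (\sum_(j < m) `|d (2 * N - n + k + j)%N|
   + (m%:R / N%:R * Sd + Sm + `|tent_average N|)))).
  apply: ler_sum => k _.
  have := @sub_tent_average_le N (2 * N - n + k) N0 mN _.
  rewrite -/Sd -/Sm => h.
  have {}h := h ltac:(by have := ltn_ord k; lia).
  have : `|c (2 * N - n + k)%N| <= `|c (2 * N - n + k)%N - tent_average N| + `|tent_average N|.
    by rewrite -{1}[c (2 * N - n + k)%N](subrK (tent_average N)) ler_normD.
  by move/le_trans; apply; lra.
rewrite big_split/= sumr_const card_ord -[(_ + _) *+ _]mulr_natl.
have nNR : (m%:R / N%:R : R) <= m%:R / n%:R.
  by apply: ler_wpM2l => //; rewrite lef_pV2 ?posrE ?ltr0n ?ler_nat.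
apply: (@le_trans _ _ (m%:R * Sd + (n.*2.+1)%:R * (m%:R / n%:R * Sd + Sm + `|tent_average N|))).
  apply: lerD; first by apply: norm_sum_shift_le; lia.
  apply: ler_wpM2l => //; rewrite !lerD2r; exact: ler_wpM2r.
suff : m%:R * Sd <= n.*2.+1%:R * (m%:R / n%:R * Sd) by lra.
rewrite mulrA; apply: ler_wpM2r => //; rewrite mulrCA ler_peMr//.
by rewrite ler_pdivlMr ?ltr0n// mul1r ler_nat; lia.
Qed.

(** Meant for time 0, where the value at the central index [2 * N] vanishes. *)
Lemma tent_average_le N : (0 < N)%N -> (m <= N)%N ->
  `|tent_average N| <= `|c (2 * N)%N| + \sum_(k < m) `|d (2 * N + k)%N|
     + m%:R / N%:R * (\sum_(z < (4 * N).+1) `|d z|)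
     + \sum_(z < (4 * N).+1) `|dm z|.
Proof.
move=> N0 mN; have := @sub_tent_average_le N (2 * N) N0 mN ltac:(lia).
have : `|tent_average N| <= `|c (2 * N)%N| + `|c (2 * N)%N - tent_average N|.
  have := ler_normB (c (2 * N)%N) (c (2 * N)%N - tent_average N).
  by rewrite opprB addrCA subrr addr0.
lra.
Qed.

End flatness.

(** The inner sum telescopes. The end points left over run, as [a] varies, through the blocks [2N,
    3N) and [N, 2N), each index once, so no flux gets a weight above 1: up to the factor N^2 this is
    the second difference of the tent. *)
Lemma tent_flux_le (R : realType) (j : nat -> R) (N : nat) :
  `|\sum_(a < N) \sum_(i < N) (j (2 * N + i - a)%N - j (2 * N + i - a).-1)|
    <= \sum_(p < (4 * N).+1) `|j p|.
Proof.
have -> : \sum_(a < N) \sum_(i < N) (j (2 * N + i - a)%N - j (2 * N + i - a).-1) =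
  \sum_(a < N) (j (3 * N - a).-1 - j (2 * N - a).-1).
  apply: eq_bigr => a _; have aN := ltn_ord a.
  under eq_bigr => i _.
    rewrite (_ : (2 * N + i - a)%N = (2 * N - a).-1 + i.+1)%N; last lia.
    rewrite (_ : ((2 * N - a).-1 + i.+1).-1 = (2 * N - a).-1 + i)%N; last lia.
    over.
  rewrite -(big_mkord xpredT (fun i => j ((2 * N - a).-1 + i.+1)%N - j ((2 * N - a).-1 + i)%N)).
  rewrite (telescope_sumr (fun i => j ((2 * N - a).-1 + i)%N))// addn0.
  by congr (j _ - _); lia.
rewrite sumrB; apply: le_trans (ler_normB _ _) _.
have bnd M : (N <= M <= (4 * N).+1)%N ->
    `|\sum_(a < N) j (M - a).-1| <= \sum_(M - N <= p < M) `|j p|.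
  move=> MN; apply: le_trans (ler_norm_sum _ _ _) _.
  rewrite -[(M - N)%N]add0n big_addn (_ : (M - (M - N))%N = N); last lia.
  rewrite big_mkord (reindex_inj rev_ord_inj) /= le_eqVlt; apply/orP; left; apply/eqP.
  by apply: eq_bigr => i _; congr (`|j _|); have := ltn_ord i; lia.
apply: le_trans (lerD (bnd (3 * N)%N _) (bnd (2 * N)%N _)) _; [lia|lia|].
rewrite -(big_mkord xpredT (fun p => `|j p|)) addrC.
rewrite (_ : (2 * N - N = N)%N); last lia.
rewrite (_ : (3 * N - N = 2 * N)%N); last lia.
rewrite -big_cat_nat; [|lia|lia].
rewrite (@big_cat_nat _ _ _ N 0%N (4 * N).+1) /=; [|lia|lia].
rewrite (@big_cat_nat _ _ _ (3 * N) N (4 * N).+1) /=; [|lia|lia].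
by rewrite addrCA lerDl addr_ge0// sumr_ge0.
Qed.

(** * Absolutely continuous functions *)

Section integral_small.
Variable R : realType.
Local Notation lambda := (@lebesgue_measure R).

Lemma integral_abs_small (u : R -> R) : lambda.-integrable setT (EFin \o u) ->
  forall eps : R, 0 < eps -> exists2 delta : R, 0 < delta &
    forall A : set (measurableTypeR R), measurable A -> (lambda A < delta%:E)%E ->
      (\int[lambda]_(x in A) `|u x|%:E <= eps%:E)%E.
Proof.
move=> iu eps eps0.
have mu : measurable_fun setT (u : measurableTypeR R -> R).
  by apply/measurable_EFinP; case/integrableP: iu.
have ia : lambda.-integrable setT (fun x => `|u x|%:E) by exact: integrable_abse iu.
pose f_ (n : nat) (x : R) : \bar R := (Num.max (`|u x| - n%:R) 0)%:E.
have mf_ n : measurable_fun (setT : set (measurableTypeR R)) (f_ n).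
  apply/measurable_EFinP; apply: measurable_maxr => //.
  by apply: measurable_funB => //; exact: measurableT_comp.
have f_0 n x : (0 <= f_ n x)%E by rewrite lee_fin le_max lexx orbT.
have [_ _ cv] : [/\ lambda.-integrable setT (cst 0%E : R -> \bar R),
    [sequence (\int[lambda]_x `|f_ n x - cst 0%E x|)%E]_n @ \oo --> 0%E
  & [sequence (\int[lambda]_x f_ n x)%E]_n @ \oo --> (\int[lambda]_x cst 0%E x)%E].
  apply: (dominated_convergence _ mf_ _ _ ia) => //.
  - apply: aeW => x _; apply: cvg_near_cst; near=> n; rewrite /f_; congr (_%:E).
    apply/max_idPr; rewrite subr_le0; near: n; exact: nbhs_infty_ger.
  - apply: aeW => x n _; rewrite gee0_abs// lee_fin ge_max normr_ge0 andbT.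
    by rewrite gerBl.
have {cv} : [sequence (\int[lambda]_x f_ n x)%E]_n @ \oo --> 0%E.
  by move: cv; rewrite integral0.
move=> cv.
have e20 : (0 < (eps / 2)%:E)%E by rewrite lte_fin divr_gt0.
have [n _ hn] : \forall n \near \oo, (\int[lambda]_x f_ n x < (eps / 2)%:E)%E.
  exact: (cv _ (open_nbhs_nbhs (conj (open_ereal_lt_ereal (x := _)) e20))).
have {hn}/= hn := hn n (leqnn n).
have n10 : 0 < n%:R + 1 :> R by rewrite ltr_wpDl.
exists (eps / 2 / (n%:R + 1)); first by rewrite !divr_gt0.
move=> A mA lA.
have muA D : measurable_fun D (u : measurableTypeR R -> R) by exact: measurable_funS mu.
apply: (@le_trans _ _ (\int[lambda]_(x in A) (f_ n x + n%:R%:E))%E).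
  apply: ge0_le_integral => //.
  - by apply/measurable_EFinP; exact: measurableT_comp.
  - by apply: emeasurable_funD => //; exact: measurable_funS (mf_ n).
  - by move=> x _; rewrite /f_ -EFinD lee_fin -lerBlDr le_max lexx.
rewrite ge0_integralD//; [|exact: measurable_funS (mf_ n)].
rewrite [eps]splitr EFinD; apply: leeD.
  apply: le_trans (ltW hn); apply: ge0_subset_integral => //.
rewrite integral_cst// -/(cst _); apply: (@le_trans _ _ ((n%:R + 1)%:E * lambda A)%E).
  by apply: lee_wpmul2r => //; rewrite lee_fin lerDl.
have -> : ((eps / 2)%:E = (n%:R + 1)%:E * (eps / 2 / (n%:R + 1))%:E)%E.
  by rewrite -EFinM; congr EFin; field; rewrite gt_eqF.
by apply: lee_wpmul2l; [rewrite lee_fin ltW | exact: ltW].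
Unshelve. all: by end_near. Qed.

End integral_small.

Section absolute_continuity.
Variable R : realType.
Local Notation lambda := (@lebesgue_measure R).
Implicit Types (f u : R -> R).

(** A list, because the real induction below appends intervals on the right; the indexed family
    required by [locally_abs_continuous] is recovered from it in [abs_continuous_chain]. *)
Definition chain (c : R) (s : seq (R * R)) :=
  pairwise (fun p q : R * R => p.2 <= q.1) s &&
  all (fun p : R * R => [&& 0 <= p.1, p.1 <= p.2 & p.2 <= c]) s.

Lemma chain_rcons c d s : 0 <= c -> c <= d -> chain c s -> chain d (rcons s (c, d)).
Proof.
move=> c0 cd /andP[ps /allP as_]; apply/andP; split.
  rewrite pairwise_rcons ps andbT; apply/allP => p /as_ /=.
  by case/and3P.
rewrite all_rcons/= c0 cd lexx /=; apply/allP => p /as_ /and3P[-> -> pc] /=.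
exact: le_trans cd.
Qed.

Lemma abs_continuous_chain f b eps : 0 < eps -> locally_abs_continuous f ->
  exists2 delta : R, 0 < delta & forall s, chain b s ->
    \sum_(p <- s) (p.2 - p.1) < delta -> \sum_(p <- s) `|f p.2 - f p.1| < eps.
Proof.
move=> eps0 acf; have [delta d0 h] := acf 0 b eps eps0.
exists delta => // s /andP[ps /allP as_] sd.
have e F : \sum_(p <- s) F p = \sum_(i < size s) F (nth (0, 0) s i) :> R.
  by rewrite (big_nth (0, 0)) big_mkord.
rewrite e; apply: (h (size s) (fun i => (nth (0, 0) s i).1) (fun i => (nth (0, 0) s i).2)).
- by move=> i; have /and3P[] := as_ _ (mem_nth (0, 0) (ltn_ord i)).
- have lt_dis (i j : 'I_(size s)) x : (i < j)%N ->
      `](nth (0, 0) s i).1, (nth (0, 0) s i).2[%classic x ->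
      `](nth (0, 0) s j).1, (nth (0, 0) s j).2[%classic x -> False.
    move=> ij; rewrite /= !in_itv/= => /andP[_ xi] /andP[xj _].
    have := pairwiseP (0, 0) ps i j (ltn_ord i) (ltn_ord j) ij => /= hij.
    by have := lt_trans (lt_le_trans xi hij) xj; rewrite ltxx.
  move=> i j _ _ [x [xi xj]]; apply: val_inj.
  by case: (ltngtP i j) => // [/lt_dis/(_ xi xj)|/lt_dis/(_ xj xi)].
- by move: sd; rewrite e.
Qed.

Lemma derivable_zero_small (G : R -> R) (s eps : R) : 0 < eps -> derivable G s 1 ->
  derive1 G s = 0 -> exists2 eta : R, 0 < eta &
    forall y, `|y - s| < eta -> `|G y - G s| <= eps * `|y - s|.
Proof.
move=> eps0 dG G0.
have : h^-1 *: (G (h + s) - G s) @[h --> 0^'] --> derive1 G s.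
  rewrite derive1E.
  have <- : (fun h => h^-1 *: (G (h *: 1 + s) - G s)) = (fun h => h^-1 *: (G (h + s) - G s)).
    by apply/funext => h; rewrite [h *: _]mulr1.
  exact: dG.
rewrite G0 => /cvgrPdist_lt /(_ eps eps0) [eta /= eta0 h].
exists eta => // y ys.
have [->|ys0] := eqVneq y s; first by rewrite !subrr normr0 mulr0.
have ys0' : y - s != 0 by rewrite subr_eq0.
have := h (y - s); rewrite /= sub0r normrN => /(_ ys ys0').
rewrite sub0r normrN subrK normrZ normfV => /ltW.
by rewrite ler_pdivrMl ?normr_gt0// mulrC.
Qed.

(* Real induction along [0, T]: where the derivative of [f - F] vanishes the
   increment is small, and points of [N] are covered by an open set of small
   measure, on which absolute continuity bounds the variation. *)
Lemma eq0_derive_constant f u (T : R) (N : set R) : 0 <= T ->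
  locally_abs_continuous f -> lambda.-integrable setT (EFin \o u) ->
  lambda.-negligible N ->
  let F y := \int[lambda]_(t in `[0, y]) u t in
  (forall s, 0 <= s <= T -> ~ N s ->
    derivable (fun y => f y - F y) s 1 /\ derive1 (fun y => f y - F y) s = 0) ->
  f T - F T = f 0 - F 0.
Proof.
move=> T0 acf iu nN F dG.
pose G y := f y - F y.
(* [eps * T] comes from the points with zero derivative; the other two [eps] are the variation of
   [f] and the integral of [|u|] over the open cover of [N]. *)
suff key eps : 0 < eps -> `|G T - G 0| <= eps * (T + 2).
  apply/eqP; rewrite -subr_eq0 -normr_le0; apply/ler_addgt0Pl => e e0.
  have T2 : 0 < T + 2 by rewrite ltr_wpDl.
  by rewrite addr0; have := key (e / (T + 2)); rewrite divfK ?gt_eqF// divr_gt0//; exact.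
move=> eps0.
have [d1 d10 h1] := @abs_continuous_chain f T eps eps0 acf.
have [d2 d20 h2] := integral_abs_small iu eps0.
have mu A : measurable_fun A (u : measurableTypeR R -> R).
  by apply: (@measurable_funS _ _ _ _ setT) => //; apply/measurable_EFinP; case/integrableP: iu.
(* Halved so that the non-strict bound on the measure of [U] becomes strict below both [d1] and
   [d2]. *)
pose delta := Num.min d1 d2 / 2.
have delta0 : 0 < delta by rewrite divr_gt0// lt_min d10.
have [U [oU NU lU]] := @outer_measure_open_le R N delta delta0.
have N0 : (wlength idfun)^*%mu N = 0%E.
  move: nN => [Z [mZ Z0 NZ]]; apply/eqP; rewrite eq_le outer_measure_ge0 andbT.
  by rewrite -Z0; exact: le_outer_measure.
rewrite N0 add0e in lU.
have mU : measurable (U : set (measurableTypeR R)) by exact: open_measurable.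
have min2 : delta < Num.min d1 d2 by rewrite /delta ltr_pdivrMr// mulr2n ltr_pMr ?lt_min ?d10// ltrDl ltr01.
have lU1 : (lambda U < d1%:E)%E.
  by apply: (le_lt_trans lU); rewrite lte_fin (lt_le_trans min2)// ge_min lexx.
have lU2 : (lambda U < d2%:E)%E.
  by apply: (le_lt_trans lU); rewrite lte_fin (lt_le_trans min2)// ge_min lexx orbT.
pose part c := U `&` `[0, c]%classic.
have mpart c : measurable (part c : set (measurableTypeR R)) by apply: measurableI.
have mabs A : measurable_fun A (fun x : measurableTypeR R => `|u x|%:E).
  by apply/measurable_EFinP; exact: measurableT_comp.
have iuS (A : set (measurableTypeR R)) : measurable A -> lambda.-integrable A (EFin \o u).
  by move=> mA; exact: integrableS iu.
pose J (A : set R) := fine (\int[lambda]_(x in A) `|u x|%:E)%E.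
have JE (A : set (measurableTypeR R)) : measurable A ->
    (\int[lambda]_(x in A) `|u x|%:E)%E = (J A)%:E.
  move=> mA; rewrite fineK// ge0_fin_numE; last by apply: integral_ge0 => x _; rewrite lee_fin.
  by have /integrableP[] := iuS A mA.
pose L c := fine (lambda (part c)).
have LE c : lambda (part c) = (L c)%:E.
  rewrite fineK// ge0_fin_numE//; apply: le_lt_trans (lt_trans lU1 (ltry _)).
  by apply: le_measure; rewrite ?inE//; exact: subIsetl.
have partU c d : 0 <= c -> c <= d -> part d = part c `|` (U `&` `]c, d]%classic).
  move=> c0 cd; rewrite -setIUr; congr (_ `&` _); apply/seteqP; split => x /=.
    by rewrite !in_itv/= => /andP[-> ->]; case: (leP x c) => xc; [left|right].
  rewrite !in_itv/= => -[] /andP[h3 h4]; apply/andP; split => //.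
  + exact: le_trans cd.
  + exact: le_trans (ltW h3).
have partD c d : [disjoint part c & U `&` `]c, d]%classic].
  apply/disj_setPLR => x [_ /=]; rewrite in_itv/= => /andP[_ xc] [_ /=].
  by rewrite in_itv/= ltNge xc.
have mUcd c d : measurable (U `&` `]c, d] : set (measurableTypeR R)) by apply: measurableI.
have lamU c d : 0 <= c -> c <= d -> ((L d)%:E = (L c)%:E + lambda (U `&` `]c, d]))%E.
  by move=> c0 cd; rewrite -!LE (partU _ _ c0 cd) measureU//; apply/disj_set2P.
have intU c d : 0 <= c -> c <= d -> J (part d) = J (part c) + J (U `&` `]c, d]%classic).
  move=> c0 cd; apply: EFin_inj; rewrite EFinD -!JE//.
  by rewrite (partU _ _ c0 cd) ge0_integral_setU//; exact: partD.
have J0 (A : set R) : 0 <= J A.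
  by apply: fine_ge0; apply: integral_ge0 => x _; rewrite lee_fin.
have FB c d : 0 <= c -> c <= d -> `|F d - F c| <= J `]c, d]%classic.
  move=> c0 cd; rewrite /F Rintegral_itvB ?bnd_simp//; last exact: iuS.
  by apply: le_normr_Rintegral => //; exact: iuS.
(* The chain records the intervals crossed inside [U] so far. Its length is kept below the measure
   of [U] up to [c], so that at [T] absolute continuity applies to the whole chain at once. *)
pose Q c := exists s, [/\ chain c s, \sum_(p <- s) (p.2 - p.1) <= L c
  & `|G c - G 0| <= eps * c + \sum_(p <- s) `|f p.2 - f p.1| + J (part c)].
have : Q T; last first.
  move=> [s [cs ls]]; have sd : \sum_(p <- s) (p.2 - p.1) < d1.
    apply: (le_lt_trans ls); rewrite -lte_fin -LE; apply: le_lt_trans lU1.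
    by apply: le_measure; rewrite ?inE//; exact: subIsetl.
  move=> /le_trans h; apply: h.
  have := h1 s cs sd => /ltW hs.
  have : J (part T) <= eps.
    rewrite -lee_fin -JE//; apply: le_trans (h2 U mU lU2); apply: ge0_subset_integral => //.
    exact: subIsetl.
  lra.
apply: (@real_induction _ Q 0 T T0).
  exists [::]; split; rewrite /chain//= !big_nil.
    by rewrite -lee_fin -LE measure_ge0.
  by rewrite subrr normr0 mulr0 !add0r.
move=> s s0 sT.
have [Ns|Ns] := pselect (N s).
  have /nbhs_ballP[eta /= eta0 etaU] : nbhs s U.
    by apply: open_nbhs_nbhs; split => //; exact: NU.
  exists eta => // c d c0 cs sd dT sc ds [ch [cch lch Gch]].
  have cd := le_trans cs sd.
  have subU : `]c, d] `<=` U.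
    move=> x /=; rewrite in_itv/= => /andP[cx xd]; apply: etaU.
    by rewrite /ball/= ltr_norml; apply/andP; split; lra.
  have UI : U `&` `]c, d] = `]c, d]%classic by apply/setIidr.
  exists (rcons ch (c, d)); split.
  - exact: chain_rcons.
  - rewrite -cats1 big_cat big_seq1/= -lee_fin (lamU c d)// UI EFinD; apply: leeD => //.
    rewrite lebesgue_measure_itv/= lte_fin; case: ltP => //.
    by move=> dc; rewrite lee_fin subr_le0.
  - rewrite -cats1 big_cat big_seq1/= (intU c d)// UI.
    have -> : G d - G 0 = (G c - G 0) + (f d - f c) - (F d - F c) by rewrite /G; ring.
    have := ler_normB ((G c - G 0) + (f d - f c)) (F d - F c).
    have := ler_normD (G c - G 0) (f d - f c).
    have := FB c d c0 cd.
    have : eps * c <= eps * d by rewrite ler_pM2l.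
    move: Gch; lra.
(* Outside [N] the chain stays as it is, and the step from [c] through [s] to [d] costs
   [eps * (s - c) + eps * (d - s)]. *)
have [dGs Gs0] := dG s ltac:(by rewrite s0 sT) Ns.
have [eta eta0 etaG] := derivable_zero_small eps0 dGs Gs0.
exists eta => // c d c0 cs sd dT sc ds [ch [cch lch Gch]].
have cd := le_trans cs sd.
exists ch; split.
- move: cch => /andP[h3 h4]; apply/andP; split => //; apply: sub_all h4 => p.
  by move=> /and3P[-> -> pc]; exact: le_trans cd.
- by apply: (le_trans lch); rewrite -lee_fin (lamU c d)// leeDl.
- have := etaG d; have := etaG c; rewrite !ltr_norml => hc hd.
  have {}hc := hc ltac:(by apply/andP; split; lra).
  have {}hd := hd ltac:(by apply/andP; split; lra).
  move: hc hd; rewrite [`|c - s|]ler0_norm ?subr_le0// [`|d - s|]ger0_norm ?subr_ge0// => hc hd.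
  have -> : G d - G 0 = (G c - G 0) - (G c - G s) + (G d - G s) by ring.
  have := ler_normD ((G c - G 0) - (G c - G s)) (G d - G s).
  have := ler_normB (G c - G 0) (G c - G s).
  have := intU c d c0 cd; have := J0 (U `&` `]c, d]%classic).
  move: Gch hc hd; rewrite /G; lra.
Qed.

End absolute_continuity.

Lemma integral_leb (R : realType) (D : set R) (f : R -> \bar R) :
  measurable (D : set (measurableTypeR R)) ->
  measurable_fun (D : set (measurableTypeR R)) f ->
  (\int[leb R]_(x in D) f x = \int[@lebesgue_measure R]_(x in D) f x)%E.
Proof.
move=> mD mf; rewrite integralE [RHS]integralE !ge0_integral_leb//.
- exact: measurable_funeneg.
- exact: measurable_funepos.
Qed.

Section fundamental_theorem.
Variable R : realType.
Local Notation lambda := (@lebesgue_measure R).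

(** Moves from the completed measure to the Borel one, where Lebesgue differentiation is applied:
    [v] is cut off to 0 outside [0, T] and replaced by a Borel version. *)
Lemma leb_integrable_version (v : R -> R) (T : R) :
  (leb R).-integrable `[0, T] (EFin \o v) ->
  exists u, [/\ lambda.-integrable setT (EFin \o u),
    {ae lambda, forall s, `[0, T]%classic s -> v s = u s}
  & forall t, t <= T ->
     \int[leb R]_(s in `[0, t]) v s = \int[lambda]_(s in `[0, t]) u s].
Proof.
move=> iv.
have mI t : measurable (`[0, t]%classic : set (lebT R)).
  by apply: measurable_leb; exact: measurable_itv.
have mv1 : measurable_fun (setT : set (lebT R)) (v \_ `[0, T]).
  apply/(measurable_restrictT _ (mI T)).
  by apply/measurable_EFinP; case/integrableP: iv.
have [u [mu vu]] := leb_borel_version mv1.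
have vu' : {ae lambda, forall s, `[0, T]%classic s -> v s = u s}.
  by apply: ae_mono vu _ => s /= <- sT; rewrite patchE mem_set.
exists u; split => //.
  apply/integrableP; split; first exact/measurable_EFinP.
  have <- := @ae_eq_integral_leb R (fun s => `|(v \_ `[0, T]) s|) (fun s => `|u s|) setT.
  - case/integrableP: iv => _; rewrite integral_mkcond; apply: le_lt_trans.
    rewrite le_eqVlt; apply/orP; left; apply/eqP; apply: eq_integral => s _.
    by rewrite !patchE; case: ifP => // _; rewrite normr0.
  - exact: measurableT_comp.
  - by apply: ae_mono vu _ => s ->.
  - by move=> ?.
  - by move=> ?.
  - exact: measurableT.
move=> t tT; rewrite /Rintegral; congr fine.
have mut : measurable_fun (`[0, t] : set (measurableTypeR R)) (EFin \o u).
  by apply/measurable_EFinP; exact: measurable_funS mu.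
rewrite -(@integral_leb R `[0, t]%classic (EFin \o u))//.
have tTs : `[0, t] `<=` `[0, T] by apply: subset_itvl; rewrite bnd_simp.
apply: ae_eq_integral => //.
- by apply: (measurable_funS (mI T) tTs); case/integrableP: iv.
- apply: measurable_fun_leb => //.
- apply/leb_negligible; apply: negligibleS vu' => s /= h hs; apply: h => /tTs sT.
  by rewrite /= hs.
Qed.

Lemma absolutely_continuous_FTC (f v : R -> R) (T : R) : 0 <= T ->
  locally_abs_continuous f -> (leb R).-integrable `[0, T] (EFin \o v) ->
  {ae leb R, forall t, derivable f t 1 /\ derive1 f t = v t} ->
  f T - f 0 = \int[leb R]_(s in `[0, T]) v s.
Proof.
move=> T0 acf iv df.
have [u [iu vu ivu]] := leb_integrable_version iv.
rewrite ivu//.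
pose F y := \int[lambda]_(t in `[0, y]) u t.
have {}df : {ae lambda, forall t, derivable f t 1 /\ derive1 f t = v t}.
  exact/leb_negligible.
have lpt := lebesgue_differentiation (open_integrable_locally openT iu).
(* Off [N] the primitive [F] has derivative [u s] at the Lebesgue point [s], and [u s = v s] is also
   the derivative of [f]. The point 0 goes into [N] because [F] starts there and the derivative is
   two-sided. *)
pose N := [set 0] `|` [set T] `|` ~` [set s | lebesgue_pt u s]
  `|` ~` [set s | `[0, T]%classic s -> v s = u s]
  `|` ~` [set t | derivable f t 1 /\ derive1 f t = v t].
have nN : lambda.-negligible N.
  have n1 (x : R) : lambda.-negligible [set x].
    by exists [set x]; split => //; exact: lebesgue_measure_set1.
  by do !apply: negligibleU.
have := @eq0_derive_constant R f u T N T0 acf iu nN; rewrite -/F => h.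
have F0 : F 0 = 0 by rewrite /F set_itv1 Rintegral_set1.
suff : f T - F T = f 0 - F 0 by rewrite F0 /F; lra.
apply: h => s /andP[s0 sT] Ns.
have s0' : 0 < s.
  by rewrite lt_neqAle s0 andbT; apply/eqP => h; apply: Ns; do 4 left.
have ps : lebesgue_pt u s by apply: contrapT => h; apply: Ns; left; left; right.
have vs : v s = u s.
  apply: contrapT => h; apply: Ns; left; right => /= h2; apply: h.
  by apply: h2; rewrite in_itv/= s0 sT.
have [dfs fs] : derivable f s 1 /\ derive1 f s = v s.
  by apply: contrapT => h; apply: Ns; right.
have iuS : lambda.-integrable (`[0, (s + 1)] : set (measurableTypeR R)) (EFin \o u).
  by apply: integrableS iu.
have [dFs Fs] := @FTC1_lebesgue_pt R u (BLeft 0) s (s + 1) ltac:(by rewrite ltrDl)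
  iuS
  ltac:(by rewrite lte_fin) ps.
split; first exact: derivableB.
by rewrite derive1E deriveB// -!derive1E fs Fs vs subrr.
Qed.

End fundamental_theorem.

(** * Measurability and time averages along the flow *)

Section ae_product.
Local Open Scope ereal_scope.
Context d1 d2 (T1 : measurableType d1) (T2 : measurableType d2) (R : realType).
Variable m1 : {sigma_finite_measure set T1 -> \bar R}.
Variable m2 : {sigma_finite_measure set T2 -> \bar R}.

Let null_sections (N : set (T1 * T2)) : measurable N -> (m1 \x m2) N = 0 ->
  {ae m1, forall x, m2 (xsection N x) = 0} /\ {ae m2, forall y, m1 (ysection N y) = 0}.
Proof.
move=> mN N0.
have m1N : measurable_fun setT (fun x => m2 (xsection N x)) by exact: measurable_fun_xsection.
have m2N : measurable_fun setT (fun y => m1 (ysection N y)) by exact: measurable_fun_ysection.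
have e1 : \int[m1]_x m2 (xsection N x) = 0 by [].
have e2 : \int[m2]_y m1 (ysection N y) = 0.
  rewrite -[RHS]e1; apply/esym.
  have := @indic_fubini_tonelli _ _ T1 T2 R m1 m2 N mN.
  by rewrite indic_fubini_tonelli_FE// indic_fubini_tonelli_GE.
split.
- have : \int[m1]_x `|m2 (xsection N x)| = 0.
    by rewrite -[RHS]e1; apply: eq_integral => x _; rewrite gee0_abs.
  by move/(ae_eq_integral_abs m1 measurableT m1N) => h; apply: ae_mono h _ => x; exact.
- have : \int[m2]_y `|m1 (ysection N y)| = 0.
    by rewrite -[RHS]e2; apply: eq_integral => y _; rewrite gee0_abs.
  by move/(ae_eq_integral_abs m2 measurableT m2N) => h; apply: ae_mono h _ => x; exact.
Qed.

Lemma ae_product (Q : T1 -> T2 -> Prop) :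
  {ae (m1 \x m2), forall p, Q p.1 p.2} ->
  {ae m1, forall x, {ae m2, forall y, Q x y}} /\ {ae m2, forall y, {ae m1, forall x, Q x y}}.
Proof.
move=> [N [mN N0 QN]]; have [h1 h2] := null_sections mN N0; split.
- apply: ae_mono h1 _ => x Nx; exists (xsection N x); split => //.
    exact: measurable_xsection.
  by move=> y /= Qxy; rewrite /xsection/= inE; apply: QN => /=.
- apply: ae_mono h2 _ => y Ny; exists (ysection N y); split => //.
    exact: measurable_ysection.
  by move=> x /= Qxy; rewrite /ysection/= inE; apply: QN => /=.
Qed.

Lemma ae_snd (Q : T2 -> Prop) : {ae m2, forall y, Q y} ->
  {ae (m1 \x m2), forall p, Q p.2}.
Proof.
move=> [N [mN N0 QN]]; exists (setT `*` N); split.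
- exact: measurableX.
- by rewrite product_measure1E// N0 mule0.
- by move=> p /= Qp; split => //; exact: QN.
Qed.

End ae_product.

Section time_average.
Variables (R : realType) (P : probability (Omega R) R).
Hypothesis P_stationary : stationary P.
Local Notation lambda := (@lebesgue_measure R).

(* For the completion of [lambda \x P], so that the path [s |-> q (tau s 0 w)] can
   be handled by Fubini although [(s, w) |-> tau s 0 w] is not product measurable. *)
Definition has_measurable_flow (q : Omega R -> R) : Prop :=
  exists q' : measurableTypeR R * Omega R -> R, measurable_fun setT q' /\
    {ae (lambda \x P)%E, forall p, q (tau p.1 0 p.2) = q' p}.

Lemma has_measurable_flow_weight : jointly_measurable P ->
  has_measurable_flow (fun w => weight w 0 0).
Proof.
move=> jm; have [q' [mq' h]] := completed_measurable_version (jm 0).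
exists q'; split => //; apply: ae_mono h _ => p <-.
by rewrite weight_tau add0r addr0.
Qed.

Lemma has_measurable_flowM q1 q2 : has_measurable_flow q1 -> has_measurable_flow q2 ->
  has_measurable_flow (fun w => q1 w * q2 w).
Proof.
move=> [u1 [mu1 h1]] [u2 [mu2 h2]]; exists (fun p => u1 p * u2 p); split.
  exact: measurable_funM.
have : {ae (lambda \x P)%E, forall p, q1 (tau p.1 0 p.2) = u1 p /\ q2 (tau p.1 0 p.2) = u2 p}.
  apply: (@negligibleS _ _ _ _ _ _ _ (negligibleU h1 h2)).
  by move=> p /= /not_andP.
by move=> h; apply: ae_mono h _ => p [-> ->].
Qed.

Lemma has_measurable_flow_norm q : has_measurable_flow q ->
  has_measurable_flow (fun w => `|q w|).
Proof.
move=> [u [mu h]]; exists (fun p => `|u p|); split; first exact: measurableT_comp.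
by apply: ae_mono h _ => p ->.
Qed.

Let grid (n : nat) (s : R) : R := (Num.floor (s * n.+1%:R))%:~R / n.+1%:R.

Let grid_cvg s : grid ^~ s @ \oo --> s.
Proof.
apply/cvgrPdist_le => e e0; near=> n.
have n0 : 0 < n.+1%:R :> R by rewrite ltr0n.
have := floor_le (s * n.+1%:R); have := floorD1_gt (s * n.+1%:R).
rewrite intrD => h1 h2.
apply: (@le_trans _ _ n.+1%:R^-1); last by apply: ltW; near: n; exact: (near_infty_natSinv_lt (PosNum e0)).
have -> : s - grid n s = (s * n.+1%:R - (Num.floor (s * n.+1%:R))%:~R) / n.+1%:R.
  by rewrite /grid; field; rewrite gt_eqF.
rewrite normrM normfV [`|n.+1%:R|]gtr0_norm// -[leRHS]mul1r ler_pM2r ?invr_gt0//.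
by rewrite ger0_norm ?subr_ge0//; lra.
Unshelve. all: by end_near. Qed.

(** With time rounded down to a grid, preimages are countable unions of measurable rectangles, since
    [tau] at a fixed time is measurable. Continuity of the paths gives the limit off the null set
    [N], where the indicator puts 0. *)
Lemma continuous_has_measurable_flow (q : Omega R -> R) : measurable_fun setT q ->
  {ae P, forall w, continuous (fun s : R => q (tau s 0 w))} -> has_measurable_flow q.
Proof.
move=> mq cq; have [N [mN N0 QN]] := cq.
pose q' (p : measurableTypeR R * Omega R) := q (tau p.1 0 p.2) * \1_(~` N) p.2.
exists q'; split; last first.
  have : {ae P, forall w, ~ N w}.
    by exists N; split => // w /=; exact: contrapT.
  move=> /(@ae_snd _ _ _ _ _ lambda P) h; apply: ae_mono h _ => p Np.
  by rewrite /q' indicE mem_set ?mulr1.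
pose u n (p : measurableTypeR R * Omega R) := q (tau (grid n p.1) 0 p.2) * \1_(~` N) p.2.
apply: (@measurable_fun_cvg _ _ R setT u) => [n|[s w] _]; last first.
  rewrite /u /q' /= indicE; case: (boolP (w \in _)) => /= wN; last first.
    by rewrite mulr0; under eq_fun do rewrite mulr0; exact: cvg_cst.
  rewrite mulr1; under eq_fun do rewrite mulr1.
  have cw : continuous (fun s : R => q (tau s 0 w)).
    by apply: contrapT => h; move: wN; rewrite inE; apply; exact: QN.
  by move=> A /(cw s) hA; exact: (@grid_cvg s _ hA).
apply: measurable_funM; last first.
  have mI : measurable_fun setT (\1_(~` N) : Omega R -> R).
    by apply: measurable_indic; exact: measurableC.
  exact: (measurableT_comp mI measurable_snd).
move=> _ B mB; rewrite setTI.
have -> : (fun p : measurableTypeR R * Omega R => q (tau (grid n p.1) 0 p.2)) @^-1` B =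
  \bigcup_(k : int) ((`[k%:~R / n.+1%:R, (k + 1)%:~R / n.+1%:R[%classic : set (measurableTypeR R)) `*`
      ((fun w => q (tau (k%:~R / n.+1%:R) 0 w)) @^-1` B)).
  have n0 : 0 < n.+1%:R :> R by rewrite ltr0n.
  apply/seteqP; split => [[s w] /= Bs|[s w] [k _ [/=]]].
    exists (Num.floor (s * n.+1%:R)) => //; split => //=.
    by rewrite in_itv/= ler_pdivrMr// ltr_pdivlMr// floor_itv.
  rewrite in_itv/= ler_pdivrMr// ltr_pdivlMr// => ks.
  by rewrite /grid (floor_def ks).
apply: countable_bigcupT_measurable => // k; apply: measurableX => //.
rewrite -[X in measurable X]setTI.
exact: (measurableT_comp mq (measurable_tau _ _)).
Qed.

(** [F] integrates a product measurable version of the flow over [0, 1]; Tonelli and stationarity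
    give it the mean of [q]. It makes continuous time accessible to the maximal inequality over
    integer times. *)
Lemma time_average (q : Omega R -> R) : measurable_fun setT q -> (forall w, 0 <= q w) ->
  has_measurable_flow q ->
  exists F : Omega R -> \bar R,
  [/\ measurable_fun setT F, forall w, (0 <= F w)%E,
      (\int[P]_w F w = \int[P]_w (q w)%:E)%E
    & {ae P, forall w, measurable_fun (setT : set (lebT R)) (fun s => q (tau s 0 w)) /\
        forall k : nat, (\int[leb R]_(s in `[k%:R, (k%:R + 1)%R]) (q (tau s 0 w))%:E =
          F (tau k%:R 0 w))%E}].
Proof.
move=> mq q0 [q' [mq' qq']].
(* Truncation makes the version nonnegative everywhere, as Tonelli requires, and changes nothing
   where it agrees with [q >= 0]. *)
pose q1 p := Num.max (q' p) 0.
have q10 p : 0 <= q1 p by rewrite le_max lexx orbT.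
have mq1 : measurable_fun setT q1 by apply: measurable_maxr.
have {mq'} qq1 : {ae (lambda \x P)%E, forall p, q (tau p.1 0 p.2) = q1 p}.
  apply: ae_mono qq' _ => p e; rewrite /q1 -e.
  by apply/esym/max_idPl.
have qq2 : {ae (lambda \x P)%E, forall p, q (tau p.1 0 p.2) = q1 (p.1, p.2)}.
  by apply: ae_mono qq1 _ => -[].
have [hs hw] := @ae_product _ _ _ _ _ lambda P (fun s w => q (tau s 0 w) = q1 (s, w)) qq2.
pose f (p : measurableTypeR R * Omega R) : \bar R := (q1 p * \1_`[0, 1] p.1)%:E.
have f0 p : (0 <= f p)%E by rewrite lee_fin mulr_ge0// indicE.
have mf : measurable_fun setT f.
  apply/measurable_EFinP; apply: measurable_funM => //.
  have mI : measurable_fun setT (\1_`[0, 1] : measurableTypeR R -> R).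
    by apply: measurable_indic; exact: measurable_itv.
  exact: (measurableT_comp mI measurable_fst).
pose F := fubini_G lambda f.
have FE w : F w = (\int[lambda]_(s in `[0%R, 1%R]) (q1 (s, w))%:E)%E.
  rewrite /F /fubini_G [RHS]integral_mkcond; apply: eq_integral => s _.
  by rewrite /f patchE indicE/=; case: ifP => _; rewrite ?mulr1 ?mulr0.
have mq1w w : measurable_fun setT (fun s : measurableTypeR R => q1 (s, w)).
  by apply: measurableT_comp.
exists F; split.
- exact: measurable_fun_fubini_tonelli_G.
- by move=> w; apply: integral_ge0.
- transitivity (\int[lambda]_s \int[P]_w f (s, w))%E.
    by apply/esym; exact: fubini_tonelli.
  transitivity (\int[lambda]_s ((\1_`[0%R, 1%R] s)%:E * \int[P]_w (q w)%:E))%E.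
    apply: ge0_ae_eq_integral => //.
    + exact: measurable_fun_fubini_tonelli_F.
    + by apply: emeasurable_funM => //; apply/measurable_EFinP.
    + by move=> s _; exact: integral_ge0.
    + move=> s _; apply: mule_ge0; first by rewrite lee_fin indicE.
      by apply: integral_ge0 => w _; rewrite lee_fin.
    + apply: ae_mono hs _ => s hs _.
      have mq1s : measurable_fun setT (fun w => q1 (s, w)) by exact: measurableT_comp.
      rewrite -(@integral_tau R P P_stationary s 0 (EFin \o q)); last 2 first.
      * exact/measurable_EFinP.
      * by move=> w; rewrite lee_fin.
      rewrite -ge0_integralZl//=; last 2 first.
      * apply/measurable_EFinP; apply: measurableT_comp => //; exact: measurable_tau.
      * by move=> w _; rewrite lee_fin.
      apply: ge0_ae_eq_integral => //.
      * by apply: (measurableT_comp mf).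
      * apply/measurable_EFinP; apply: measurable_funM => //.
        by apply: measurableT_comp => //; exact: measurable_tau.
      * by move=> w _; rewrite lee_fin mulr_ge0// indicE.
      * by apply: ae_mono hs _ => w e _; rewrite /f/= e mulrC.
  have l1 : lambda `[0, 1] = 1%E.
    by rewrite lebesgue_measure_itv/= lte_fin ltr01 oppr0 adde0.
  rewrite ge0_integralZr//; last 2 first.
  + by apply/measurable_EFinP; apply: measurable_indic; exact: measurable_itv.
  + by apply: integral_ge0 => w _; rewrite lee_fin.
  have mI01 : measurable (`[0, 1] : set (measurableTypeR R)) by exact: measurable_itv.
  rewrite integral_indic//.
  by rewrite setIT -[RHS]mul1e; congr (_ * _)%E.
have {}hw := ae_forall_countable (fun k : nat => @ae_tau R P P_stationary k%:R 0 _ hw).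
apply: ae_mono hw _ => w hw.
have h0 := hw 0%N; rewrite tau00 in h0.
split; first exact: (ae_eq_leb_measurable (mq1w w) h0).
move=> k; rewrite (ae_eq_integral_leb (mq1w w) h0)// -ge0_integral_addr// FE.
apply: ge0_ae_eq_integral => //.
- apply/measurable_EFinP; apply: measurable_funTS.
  exact: (measurableT_comp (mq1w w) (measurable_fun_addr k%:R)).
- by apply/measurable_EFinP; apply: measurable_funTS.
- by move=> s _; rewrite lee_fin.
- by move=> s _; rewrite lee_fin.
(* The version at time [s + k] along [w] and the version at time [s] along [tau k w] both equal [q]
   at [tau (s + k) 0 w], for almost every [s]. *)
have h1 := ae_addr k%:R h0; have h2 := hw k.
apply: (@negligibleS _ _ _ _ _ _ _ (negligibleU h1 h2)) => s /= h.
apply: contrapT => /not_orP[/contrapT e1 /contrapT e2]; apply: h => _.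
by rewrite -e1 -e2 tau_tau addr0 addrC.
Qed.

End time_average.

(** * Dynamics of the corrector *)

Lemma eq_continuous_rat (R : realType) (f g : R -> R) : continuous f -> continuous g ->
  (forall q : rat, f (ratr q) = g (ratr q)) -> f = g.
Proof.
move=> cf cg fg; apply/funext => s; apply/eqP; rewrite -subr_eq0 -normr_le0.
apply/ler_addgt0Pl => e e0; rewrite addr0.
have cfg : (fun s => f s - g s) @ s --> f s - g s by apply: cvgB; [exact: cf|exact: cg].
have : \forall y \near s, `|(f s - g s) - (f y - g y)| < e.
  by move/cvgrPdist_lt : cfg; apply.
move=> /nbhs_ballP[d /= d0 hd].
have [|x [sx [q _ qx]]] := @dense_rat R (ball s d) (ex_intro _ s (ballxx s d0)).
  exact: ball_open.
have := hd _ sx; rewrite -qx fg subrr subr0 => /ltW; exact.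
Qed.

Section time_integral.
Variable R : realType.
Local Notation lambda := (@lebesgue_measure R).

Lemma time_int_continuous (v : R -> R) (t : R) : 0 < t ->
  (leb R).-integrable `[0, t + 1] (EFin \o v) -> {for t, continuous (time_int v)}.
Proof.
move=> t0 iv; have [u [iu vu ivu]] := leb_integrable_version iv.
have iuS : lambda.-integrable (`[0, (t + 1)] : set (measurableTypeR R)) (EFin \o u).
  by apply: integrableS iu.
have t10 : 0 <= t + 1 by rewrite addr_ge0// ltW.
pose F y := \int[lambda]_(s in `[0, y]) u s.
have cF : {for t, continuous F}.
  apply: (@within_continuous_continuous R R R 0 (t + 1) F).
  - by rewrite ltr_wpDl// ltW.
  - exact: parameterized_integral_continuous t10 iuS.
  - by rewrite in_itv/= t0/= ltrDl.
have FE : \forall y \near t, F y = time_int v y.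
  near=> y; rewrite /F /time_int ifT; last by apply: ltW; near: y; exact: lt_nbhsr.
  by rewrite ivu//; apply: ltW; near: y; apply: lt_nbhsl; rewrite ltrDl.
have := cF; rewrite /prop_for /continuous_at (nbhs_singleton FE).
by apply: cvg_trans; exact: near_eq_cvg.
Unshelve. all: by end_near. Qed.

End time_integral.

Section corrector_field.
Variables (R : realType) (P : probability (Omega R) R) (Phi0 : Omega R -> int -> R).
Hypotheses (P_measurable : jointly_measurable P) (P_stationary : stationary P).
Hypotheses (P_moments : finite_moments P) (Phi0_corrector : is_corrector_field P Phi0).

Definition regular_env (w : Omega R) :=
  (forall x, continuous (fun s : R => Phi0 (tau s 0 w) x)) /\
  (forall s x y, Phi0 (tau s x w) (y - x) = Phi0 (tau s 0 w) y - Phi0 (tau s 0 w) x).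

(** Along an environment, [Phi0] is [harm_coord], absolutely continuous in time, plus the integral
    of the drift, hence continuous. Continuity then extends the cocycle identity from rational times
    to all times, beyond the reach of countable unions of null sets. *)
Lemma ae_regular_env : {ae P, forall w, regular_env w}.
Proof.
have [[mPhi cPhi _] _ good] := Phi0_corrector.
have cont : {ae P, forall w, forall x, continuous (fun s : R => Phi0 (tau s 0 w) x)}.
  have := ae_forall_countable (fun k : nat => ae_tau P_stationary (- k%:R) 0 good).
  move=> h; apply: ae_mono h _ => w {}good x t.
  (* Starting the clock at [- k] makes the time in question positive, where [time_int_continuous]
     applies. *)
  pose k := Num.bound `|t|.
  have [intd [acw _] _] := good k.
  have tk : 0 < t + k%:R.
    by have := archi_boundP (normr_ge0 t); have := ler_norm (- t); rewrite normrN -/k; lra.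
  have c1 := locally_abs_continuous_continuous (acw x).
  have c2 := @time_int_continuous R _ (t + k%:R) tk (intd 0 (t + k%:R + 1)).
  have c3 : {for t + k%:R, continuous (fun s => Phi0 (tau s 0 (tau (- k%:R) 0 w)) x)}.
    have -> : (fun s => Phi0 (tau s 0 (tau (- k%:R) 0 w)) x) =
      (fun s => harm_coord Phi0 (tau (- k%:R) 0 w) s x + time_int (drift Phi0 (tau (- k%:R) 0 w)) s).
      by apply/funext => s; rewrite /harm_coord subrK.
    by apply: continuousD; [exact: c1 | exact: c2].
  have -> : (fun s => Phi0 (tau s 0 w) x) =
      (fun s => Phi0 (tau s 0 (tau (- k%:R) 0 w)) x) \o (fun s => s + k%:R).
    by apply/funext => s /=; rewrite tau_tau addr0 addrCA addNr addr0.
  apply: continuous_comp => //.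
  by apply: cvgD; [exact: cvg_id|exact: cvg_cst].
have contx := ae_forall_countable (fun x : int => ae_tau P_stationary 0 x cont).
have coc := ae_forall_countable (fun q : rat => ae_tau P_stationary (ratr q) 0 cPhi).
apply: (@negligibleS _ _ _ _ _ _ _ (negligibleU cont (negligibleU contx coc))).
move=> w /= h; apply: contrapT => /not_orP[/contrapT hc /not_orP[/contrapT hcx /contrapT hq]].
apply: h; split => // s x y.
have := @eq_continuous_rat R (fun s => Phi0 (tau s x w) (y - x))
   (fun s => Phi0 (tau s 0 w) y - Phi0 (tau s 0 w) x).
have e s' : tau s' x w = tau s' 0 (tau 0 x w) by rewrite tau_tau add0r addr0.
move=> /(_ _ _ _)/(congr1 (@^~ s)) ; apply.
- by under eq_fun do rewrite e; exact: hcx.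
- by move=> t; apply: cvgB; exact: hc.
- by move=> q; have := hq q x y; rewrite tau_tau addr0 add0r.
Qed.

End corrector_field.

Section dynamics.
Variables (R : realType) (P : probability (Omega R) R) (Phi0 : Omega R -> int -> R).
Hypotheses (P_stationary : stationary P) (Phi0_corrector : is_corrector_field P Phi0).

Definition flux (w : Omega R) : R := weight w 0 0 * Phi0 w 1.

Definition gradient_error (w : Omega R) : R := 1 - Phi0 w 1.

Lemma flux_tau (w : Omega R) (s : R) x : regular_env Phi0 w ->
  flux (tau s x w) = weight w s x * (Phi0 (tau s 0 w) (x + 1) - Phi0 (tau s 0 w) x).
Proof.
move=> [_ coc]; rewrite /flux weight_tau !add0r.
by rewrite -(coc s x (x + 1)) addrAC subrr add0r.
Qed.

Lemma generator_flux (w : Omega R) (s : R) (x : int) (f : int -> R) :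
  regular_env Phi0 w ->
  (forall y, f y - f x = Phi0 (tau s 0 w) y - Phi0 (tau s 0 w) x) ->
  generator w s f x = flux (tau s x w) - flux (tau s (x - 1) w).
Proof.
move=> rw fP; rewrite /generator /nbrs big_cons big_cons big_nil addr0 !fP.
rewrite !flux_tau// /conductance eqxx subrK eqxx.
have -> : (x - 1 == x + 1) = false by apply/eqP; lia.
by rewrite addrC; congr (_ + _); ring.
Qed.

(** The time integral in [harm_coord] does not depend on the site and cancels, so the increment is
    stationary in space-time. *)
Lemma corrector_increment (w : Omega R) (t : R) (x : int) : regular_env Phi0 w ->
  corrector Phi0 w t (x + 1) - corrector Phi0 w t x = gradient_error (tau t x w).
Proof.
move=> [_ coc]; rewrite /corrector /gradient_error /harm_coord.
have := coc t x (x + 1); rewrite addrAC subrr add0r => ->.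
by rewrite intrD; ring.
Qed.

(** The backward equation gives [harm_coord] the derivative minus the flux difference at almost
    every time; the corrector carries the opposite sign. Absolute continuity turns this into the
    integral identity. *)
Lemma ae_dynamics : {ae P, forall w, forall (x : int) (t : R), 0 <= t ->
  (leb R).-integrable `[0, t]
     (fun s => (flux (tau s x w) - flux (tau s (x - 1) w))%:E) /\
  corrector Phi0 w t x - corrector Phi0 w 0 x =
    \int[leb R]_(s in `[0, t]) (flux (tau s x w) - flux (tau s (x - 1) w))}.
Proof.
have [_ _ good] := Phi0_corrector.
have regular := ae_regular_env P_stationary Phi0_corrector.
have regularx := ae_forall_countable (fun x : int => ae_tau P_stationary 0 x regular).
have goodx := ae_forall_countable (fun x : int => ae_tau P_stationary 0 x good).
apply: (@negligibleS _ _ _ _ _ _ _ (negligibleU regularx (negligibleU good goodx))).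
move=> w /= h; apply: contrapT => /not_orP[/contrapT rx /not_orP[/contrapT g /contrapT gx]].
apply: h => x t t0.
have rw : regular_env Phi0 w by have := rx 0; rewrite tau00.
(* Integrability is given only for the drift at the origin; at [x] it is read off from the
   environment shifted by [x]. *)
have driftE s : drift Phi0 (tau 0 x w) s = flux (tau s x w) - flux (tau s (x - 1) w).
  rewrite /drift (generator_flux (rx x))// !tau_tau.
  by rewrite !add0r addr0.
have [idr _ _] := gx x.
have {idr}iv : (leb R).-integrable `[0, t]
     (fun s => (flux (tau s x w) - flux (tau s (x - 1) w))%:E).
  have -> : (fun s => (flux (tau s x w) - flux (tau s (x - 1) w))%:E) =
      EFin \o drift Phi0 (tau 0 x w) by apply/funext => s /=; rewrite driftE.
  exact: idr.
split => //.
have [_ [acw odew] _] := g.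
have := @absolutely_continuous_FTC R (fun s => harm_coord Phi0 w s x)
  (fun s => - (flux (tau s x w) - flux (tau s (x - 1) w))) t t0 (acw x).
have -> : (leb R).-integrable `[0, t]
    (EFin \o (fun s => - (flux (tau s x w) - flux (tau s (x - 1) w)))).
  by move/integrableN : iv.
move=> /(_ erefl) h.
have ode : {ae leb R, forall s, derivable (fun s => harm_coord Phi0 w s x) s 1 /\
   derive1 (fun s => harm_coord Phi0 w s x) s = - (flux (tau s x w) - flux (tau s (x - 1) w))}.
  apply: ae_mono odew _ => s /(_ x)[ds e]; split => //.
  apply/eqP; rewrite -addr_eq0 -e; apply/eqP; congr (_ + _).
  by apply/esym/generator_flux => // y; rewrite /harm_coord; ring.
have {h ode} := h ode.
have -> : \int[leb R]_(s in `[0, t]) - (flux (tau s x w) - flux (tau s (x - 1) w)) =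
   - \int[leb R]_(s in `[0, t]) (flux (tau s x w) - flux (tau s (x - 1) w)).
  rewrite -[RHS]mulN1r -RintegralZl//.
    by apply: eq_Rintegral => s _; rewrite mulN1r.
  by apply: measurable_leb; exact: measurable_itv.
by rewrite /corrector => h; rewrite -[RHS]opprK -h; ring.
Qed.

End dynamics.

(** * Moment bounds for the flux and the gradient error *)

Section moments.
Variables (R : realType) (P : probability (Omega R) R).
Hypotheses (P_stationary : stationary P) (P_moments : finite_moments P).
Lemma measurable_weight (t : R) (x : int) : measurable_fun setT (fun w : Omega R => weight w t x).
Proof.
apply: (measurability _ (RGenOInfty.measurableE R)) => // _ [_ [r ->] <-].
rewrite setTI; apply: sub_sigma_algebra.
have cw : continuous (fun w : env R => \val ((w : R * int -> pos_real R) (t, x)) : R).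
  move=> w.
  apply: (@continuous_comp _ _ _ (fun w : env R => (w : R * int -> pos_real R) (t, x))
    (fun p : pos_real R => \val p : R)).
    exact: (@proj_continuous _ (fun _ : R * int => pos_real R) (t, x)).
  exact: initial_continuous.
have oI : open `]r, +oo[%classic by exact: interval_open.
by move: oI; apply: open_comp => w _; exact: cw.
Qed.

Lemma weight_gt0 (w : Omega R) (t : R) (x : int) : (0 < weight w t x)%R.
Proof. by rewrite /weight; have := set_valP ((w : R * int -> pos_real R) (t, x)). Qed.

Lemma measurable_weightV (t : R) (x : int) :
  measurable_fun setT (fun w : Omega R => (weight w t x)^-1).
Proof.
have -> : (fun w : Omega R => (weight w t x)^-1) =
    (fun w => powR (weight w t x) (- 1)).
  by apply/funext => w; rewrite powR_inv1// ltW// weight_gt0.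
have mp := @measurable_powR R (- 1).
exact: (@measurableT_comp _ _ _ _ _ _ (fun y : R => powR y (- 1)) _ (fun w : Omega R => weight w t x) mp (measurable_weight t x)).
Qed.

Local Open Scope ereal_scope.

Lemma le_cov_sqnorm (Psi : Omega R -> int -> R) :
  (forall x, measurable_fun setT (Psi ^~ x)) ->
  \int[P]_w (weight w 0 0 * `|Psi w 1| ^+ 2)%:E <= cov_sqnorm P Psi.
Proof.
move=> mPsi; have mc y : measurable_fun setT (fun w : Omega R => conductance w 0 0 y).
  rewrite /conductance; case: (y == 0 + 1)%R; first exact: measurable_weight.
  by case: (0 == y + 1)%R => //; exact: measurable_weight.
apply: ge0_le_integral => //.
- by move=> w _; rewrite lee_fin mulr_ge0// ltW// weight_gt0.
- apply/measurable_EFinP; apply: measurable_funM; first exact: measurable_weight.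
  by apply: measurable_funX; exact: measurableT_comp.
- apply/measurable_EFinP; apply: measurable_sum => y; apply: measurable_funM => //.
  by apply: measurable_funX; exact: measurableT_comp.
move=> w _; rewrite lee_fin /nbrs !big_cons big_nil addr0 /conductance /=.
by rewrite lerDr mulr_ge0// ltW// weight_gt0.
Qed.

(* AM-GM: [|r| <= c k r^2 + 1 / (c k)] with [k] the conductance. *)
Lemma integral_norm_le (Psi : Omega R -> int -> R) (c : R) : (0 < c)%R ->
  (forall x, measurable_fun setT (Psi ^~ x)) ->
  \int[P]_w `|Psi w 1|%:E <=
    c%:E * cov_sqnorm P Psi + c^-1%:E * \int[P]_w ((weight w 0 0)^-1)%:E.
Proof.
move=> c0 mPsi.
have mw := measurable_weight 0 0.
have mwV := measurable_weightV.
have mX : measurable_fun setT (fun w => weight w 0 0 * `|Psi w 1| ^+ 2)%R.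
  apply: measurable_funM => //.
  by apply: measurable_funX; exact: measurableT_comp.
have X0 w : (0 <= weight w 0 0 * `|Psi w 1| ^+ 2)%R by rewrite mulr_ge0// ltW// weight_gt0.
have V0 (w : Omega R) : (0 <= (weight w 0 0)^-1)%R by rewrite invr_ge0; exact/ltW/weight_gt0.
apply: (@le_trans _ _ (\int[P]_w ((c * (weight w 0 0 * `|Psi w 1| ^+ 2))%:E +
    (c^-1 * (weight w 0 0)^-1)%:E))); last first.
  rewrite ge0_integralD//; last 4 first.
  - by move=> w _; rewrite lee_fin mulr_ge0// ltW.
  - by apply/measurable_EFinP; exact: measurable_funM.
  - by move=> w _; rewrite lee_fin mulr_ge0// invr_ge0 ltW.
  - by apply/measurable_EFinP; exact: measurable_funM.
  under eq_integral do rewrite EFinM.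
  rewrite ge0_integralZl//; last 3 first.
  - exact/measurable_EFinP.
  - by move=> w _; rewrite lee_fin.
  - by rewrite lee_fin ltW.
  under [X in _ + X]eq_integral do rewrite EFinM.
  rewrite ge0_integralZl//; last 3 first.
  - exact/measurable_EFinP.
  - by move=> w _; rewrite lee_fin.
  - by rewrite lee_fin invr_ge0 ltW.
  by apply: leeD => //; apply: lee_wpmul2l; [rewrite lee_fin ltW|exact: le_cov_sqnorm].
apply: ge0_le_integral => //.
- by apply/measurable_EFinP; apply: measurableT_comp.
- by apply: emeasurable_funD; apply/measurable_EFinP; exact: measurable_funM.
move=> w _; rewrite -EFinD lee_fin.
have k0 : (0 < c * weight w 0 0)%R by rewrite mulr_gt0// weight_gt0.
rewrite mulrA -invfM; move: k0; set k := (c * weight w 0 0)%R => k0.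
set r := `|Psi w 1|%R.
have r0 : (0 <= r)%R by exact: normr_ge0.
have : (0 <= k * (r - k^-1) ^+ 2)%R by rewrite mulr_ge0 ?sqr_ge0// ltW.
have -> : (k * (r - k^-1) ^+ 2 = k * r ^+ 2 - 2 * r + k^-1)%R by field; rewrite gt_eqF.
lra.
Qed.

End moments.

Section corrector_moments.
Variables (R : realType) (P : probability (Omega R) R) (Phi0 : Omega R -> int -> R).
Hypotheses (P_stationary : stationary P) (P_moments : finite_moments P).
Hypothesis Phi0_corrector : is_corrector_field P Phi0.

Lemma measurable_flux : measurable_fun setT (flux Phi0).
Proof.
have [[mPhi _ _] _ _] := Phi0_corrector.
by apply: measurable_funM => //; exact: measurable_weight.
Qed.

Lemma measurable_gradient_error : measurable_fun setT (gradient_error Phi0).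
Proof.
by have [[mPhi _ _] _ _] := Phi0_corrector; exact: measurable_funB.
Qed.

(** With [k] the conductance and [r = |Phi0 w 1|], [k r <= k r^2 + k]: here the first moment of the
    weights enters, as the inverse moment does for the gradient. *)
Lemma integral_flux_lty : (\int[P]_w `|flux Phi0 w|%:E < +oo)%E.
Proof.
have [[mPhi _ cPhi] _ _] := Phi0_corrector.
have mw := @measurable_weight R 0 0.
have mX : measurable_fun setT (fun w => weight w 0 0 * `|Phi0 w 1| ^+ 2).
  apply: measurable_funM => //.
  by apply: measurable_funX; exact: measurableT_comp.
apply: (@le_lt_trans _ _ (\int[P]_w ((weight w 0 0 * `|Phi0 w 1| ^+ 2)%:E + (weight w 0 0)%:E))%E).
  apply: ge0_le_integral => //.
  - by apply/measurable_EFinP; apply: measurableT_comp => //; exact: measurable_flux.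
  - by apply: emeasurable_funD; exact/measurable_EFinP.
  move=> w _; rewrite -EFinD lee_fin /flux normrM.
  have w0 := weight_gt0 w 0 0; rewrite gtr0_norm// -[X in _ <= _ + X]mulr1 -mulrDr.
  rewrite ler_pM2l//; set r := `|_|; have r0 : 0 <= r by exact: normr_ge0.
  by have := sqr_ge0 (r - 1); rewrite !expr2; lra.
rewrite ge0_integralD//; last 4 first.
- by move=> w _; rewrite lee_fin mulr_ge0// ltW// weight_gt0.
- exact/measurable_EFinP.
- by move=> w _; rewrite lee_fin ltW// weight_gt0.
- exact/measurable_EFinP.
apply: lte_add_pinfty; last by have [] := P_moments 0 0.
exact: le_lt_trans (le_cov_sqnorm P mPhi) cPhi.
Qed.

Let error_field (w : Omega R) (x : int) : R := x%:~R - Phi0 w x.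

Lemma integral_gradient_error_lty : (\int[P]_w `|gradient_error Phi0 w|%:E < +oo)%E.
Proof.
have [_ [[mE _ cE] _] _] := Phi0_corrector.
apply: le_lt_trans (integral_norm_le P ltr01 mE) _.
rewrite invr1 !mul1e; apply: lte_add_pinfty => //.
by have [] := P_moments 0 0.
Qed.

Definition average_error (m : nat) (w : Omega R) : R :=
  m%:R^-1 * \sum_(k < m) gradient_error Phi0 (tau 0 k%:Z w).

Lemma measurable_average_error m : measurable_fun setT (average_error m).
Proof.
apply: measurable_funM => //; apply: measurable_sum => k.
exact: measurableT_comp measurable_gradient_error (measurable_tau _ _).
Qed.

(** Write the error as the gradient of a bounded [phi] plus a remainder [r]. Averaged over [m] edges
    the gradient telescopes to at most [2 C / m], and by stationarity averaging does not increase
    the mean of [|r|]. *)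
Lemma average_error_small (eps : R) : 0 < eps ->
  exists2 m, (0 < m)%N & (\int[P]_w `|average_error m w|%:E <= eps%:E)%E.
Proof.
move=> eps0; have [_ [[mE _ cE] dE] _] := Phi0_corrector.
have [_ MV] := P_moments 0 0.
set V := (\int[P]_w _)%E in MV.
have V0 : (0 <= V)%E.
  by apply: integral_ge0 => w _; rewrite lee_fin invr_ge0 ltW// weight_gt0.
have VE : V = (fine V)%:E by rewrite fineK// ge0_fin_numE.
have fV0 : 0 <= fine V by exact: fine_ge0.
(* This makes [c^-1 * V] at most [eps / 4]; approximating within [eps / (4 * c)] in squared norm
   then leaves [eps / 4] for the other term of [integral_norm_le]. *)
pose c := (4 * (fine V + 1)) / eps.
have c0 : 0 < c by rewrite divr_gt0// mulr_gt0// ltr_wpDl.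
have d0 : 0 < eps / (4 * c) by rewrite divr_gt0// mulr_gt0.
have [phi [mphi [C hC] hphi]] := dE _ d0.
pose r w := error_field w 1 - grad phi w 1.
have mgrad x : measurable_fun setT (fun w => error_field w x - grad phi w x).
  apply: measurable_funB; first exact: mE.
  by apply: measurable_funB => //; exact: measurableT_comp mphi (measurable_tau _ _).
have ir : (\int[P]_w `|r w|%:E <= (eps / 2)%:E)%E.
  apply: le_trans (integral_norm_le P c0 mgrad) _.
  rewrite -/V VE.
  apply: (@le_trans _ _ (c%:E * (eps / (4 * c))%:E + c^-1%:E * (fine V)%:E)%E).
    by apply: leeD => //; apply: lee_wpmul2l; [rewrite lee_fin ltW|exact: ltW].
  rewrite -!EFinM -EFinD lee_fin.
  have -> : c * (eps / (4 * c)) = eps / 4 by field; rewrite gt_eqF.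
  have : c^-1 * fine V <= eps / 4.
    have V1 : 0 < fine V + 1 by rewrite ltr_wpDl.
    have -> : c^-1 * fine V = eps / 4 * (fine V / (fine V + 1)).
      by rewrite /c; field; rewrite !gt_eqF.
    apply: ler_piMr; first by rewrite divr_ge0// ltW.
    by rewrite ler_pdivrMr// mul1r lerDl.
  lra.
have C0 : 0 <= C by apply: le_trans (hC point).
pose m := (Num.bound (4 * C / eps)).+1.
exists m => //.
have mr : measurable_fun setT r by exact: mgrad.
have m0 : 0 < m%:R :> R by rewrite ltr0n.
have nm : `|m%:R^-1| = m%:R^-1 :> R by rewrite gtr0_norm// invr_gt0.
have bnd w : `|average_error m w| <= eps / 2 + m%:R^-1 * \sum_(k < m) `|r (tau 0 k%:Z w)|.
  have -> : average_error m w = m%:R^-1 * (phi (tau 0 m%:Z w) - phi w) +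
      m%:R^-1 * \sum_(k < m) r (tau 0 k%:Z w).
    rewrite /average_error -mulrDr; congr (_ * _).
    have := @telescope_sumr _ 0 m (fun k => phi (tau 0 k%:Z w)) (leq0n m).
    rewrite tau00 big_mkord => <-; rewrite -big_split/=; apply: eq_bigr => k _.
    rewrite /r /grad tau_tau addr0 /error_field /gradient_error.
    have -> : (k.+1%:Z = k%:Z + 1)%R by rewrite -addn1.
    ring.
  apply: le_trans (ler_normD _ _) _; apply: lerD.
    rewrite normrM nm ler_pdivrMl//.
    apply: le_trans (ler_normB _ _) _; apply: (le_trans (lerD (hC _) (hC _))).
    have : 4 * C / eps < m%:R.
      apply: (lt_le_trans (archi_boundP _)); last by rewrite ler_nat.
      by rewrite !divr_ge0// ?mulr_ge0// ltW.
    rewrite ltr_pdivrMr// => h; lra.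
  rewrite normrM nm ler_pM2l ?invr_gt0//.
  exact: ler_norm_sum.
have mS k : measurable_fun setT (fun w => `|r (tau 0 k w)|).
  by apply: measurableT_comp => //; exact: measurableT_comp mr (measurable_tau _ _).
apply: (@le_trans _ _ (\int[P]_w ((eps / 2)%:E + (m%:R^-1 * \sum_(k < m) `|r (tau 0 k%:Z w)|)%:E))%E).
  apply: ge0_le_integral => //.
  - by apply/measurable_EFinP; apply: measurableT_comp => //; exact: measurable_average_error.
  - apply: emeasurable_funD => //; apply/measurable_EFinP; apply: measurable_funM => //.
    exact: measurable_sum.
  - by move=> w _; rewrite -EFinD lee_fin.
rewrite ge0_integralD//; last 3 first.
- by move=> w _; rewrite lee_fin ltW// divr_gt0.
- by move=> w _; rewrite lee_fin mulr_ge0// sumr_ge0.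
- apply/measurable_EFinP; apply: measurable_funM => //; exact: measurable_sum.
rewrite integral_cst//= probability_setT mule1.
rewrite [leRHS](_ : _ = (eps / 2)%:E + (eps / 2)%:E)%E; last by rewrite -EFinD -splitr.
apply: leeD => //.
under eq_integral do rewrite EFinM -sumEFin.
rewrite ge0_integralZl//; last 2 first.
- by apply: emeasurable_sum => k; exact/measurable_EFinP.
- by move=> w _; apply: sume_ge0 => k _; rewrite lee_fin.
rewrite ge0_integral_sum//; last by move=> k; exact/measurable_EFinP.
rewrite (eq_bigr (fun=> (\int[P]_w `|r w|%:E)%E)); last first.
  move=> k _; rewrite -(@integral_tau R P P_stationary 0 k%:Z (fun w => `|r w|%:E))//.
  by apply/measurable_EFinP; exact: measurableT_comp.
rewrite lee_pdivrMl//.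
apply: (@le_trans _ _ (\sum_(k < m) (eps / 2)%:E)%E); first exact: lee_sum.
by rewrite sumEFin sumr_const card_ord -EFinM lee_fin mulr_natl.
Qed.

End corrector_moments.

(** * Space-time averages of the corrector *)

Lemma Rintegral_sum d (T : measurableType d) (R : realType)
    (mu : {measure set T -> \bar R}) (D : set T) (I : Type) (s : seq I) (f : I -> T -> R) :
  measurable D -> (forall i, mu.-integrable D (EFin \o f i)) ->
  \int[mu]_(x in D) (\sum_(i <- s) f i x) = \sum_(i <- s) \int[mu]_(x in D) f i x.
Proof.
move=> mD fi; rewrite /Rintegral.
under eq_integral do rewrite -sumEFin.
rewrite (@integral_sum _ _ _ mu D mD I (fun i => EFin \o f i) fi s xpredT).
rewrite (eq_bigr (fun i => (fine (\int[mu]_(x in D) (f i x)%:E)%E)%:E)).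
  by rewrite sumEFin.
by move=> i _; rewrite fineK; [|exact: (integrable_fin_num mD (fi i))].
Qed.

Definition box_site (N p : nat) : int := p%:Z - (2 * N)%N%:Z.

Definition spatial_increment (T : Type) (R : realType) (c : T -> int -> R)
    (s : T) (x : int) : R := c s (x + 1) - c s x.

Definition averaged_increment (T : Type) (R : realType) (c : T -> int -> R)
    (m : nat) (s : T) (x : int) : R :=
  m%:R^-1 * \sum_(k < m) spatial_increment c s (x + k%:Z).

Section time_slices.
Variables (d : measure_display) (T : measurableType d) (R : realType).
Variables (mu : {measure set T -> \bar R}) (I : set T).
Hypothesis mI : measurable I.

(** In use [D] is [0, s] and [I] is [0, n^2], so the bound is uniform in [s]. By linearity the tent
    average moves under the integral, where [tent_flux_le] applies at each time. *)
Lemma tent_flux_integral_le (j : T -> int -> R) (D : set T) (Delta : int -> R)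
    (N : nat) (C : R) :
  measurable D -> D `<=` I ->
  (forall x, measurable_fun setT (j ^~ x)) ->
  (forall x, mu.-integrable D (fun s => (j s x - j s (x - 1))%:E) /\
    Delta x = \int[mu]_(s in D) (j s x - j s (x - 1))) ->
  (\sum_(p < (4 * N).+1) \int[mu]_(s in I) `|j s (box_site N p)|%:E <= C%:E)%E ->
  `|tent_average (fun p => Delta (box_site N p)) N| <= (N%:R ^+ 2)^-1 * C.
Proof.
move=> mD DI mj DeltaE jC.
pose g (a i : nat) (s : T) :=
  j s (box_site N (2 * N + i - a)%N) - j s (box_site N (2 * N + i - a).-1).
have gi (a i : 'I_N) : mu.-integrable D (EFin \o g a i) /\
    Delta (box_site N (2 * N + i - a)%N) = \int[mu]_(s in D) g a i s.
  have [h1 h2] := DeltaE (box_site N (2 * N + i - a)%N).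
  have sE : box_site N (2 * N + i - a)%N - 1 = box_site N (2 * N + i - a).-1.
    by rewrite /box_site; clear; case: a i => a ha [i hi] /=; lia.
  by rewrite sE in h1 h2.
pose G s := \sum_(a < N) \sum_(i < N) g a i s.
have iGa (a : 'I_N) : mu.-integrable D (EFin \o (fun s => \sum_(i < N) g a i s)).
  have -> : EFin \o (fun s => \sum_(i < N) g a i s) =
      (fun s => \sum_(i < N) (g a i s)%:E)%E.
    by apply/funext => s /=; rewrite sumEFin.
  by apply: integrable_sum => // i _; exact: (gi a i).1.
have iG : mu.-integrable D (EFin \o G).
  have -> : EFin \o G = (fun s => \sum_(a < N) (\sum_(i < N) g a i s)%:E)%E.
    by apply/funext => s /=; rewrite /G -sumEFin.
  by apply: integrable_sum => // a _; exact: iGa.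
rewrite /tent_average.
have -> : \sum_(a < N) \sum_(i < N) Delta (box_site N (2 * N + i - a)%N) =
    \int[mu]_(s in D) G s.
  rewrite Rintegral_sum//; apply: eq_bigr => a _.
  rewrite Rintegral_sum//; last by move=> i; exact: (gi a i).1.
  by apply: eq_bigr => i _; rewrite (gi a i).2.
rewrite normrM ger0_norm ?invr_ge0 ?exprn_ge0//; apply: ler_wpM2l.
  by rewrite invr_ge0 exprn_ge0.
have mabs x A : measurable_fun A (fun s => `|j s x|%:E).
  apply/measurable_EFinP; apply: measurable_funTS; exact: measurableT_comp.
rewrite -lee_fin EFin_normr_Rintegral//.
apply: le_trans (le_abse_integral _ _ _) _ => //; first by case/integrableP: iG.
apply: (@le_trans _ _ (\int[mu]_(s in D)
    (\sum_(p < (4 * N).+1) `|j s (box_site N p)|%:E))%E).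
  apply: ge0_le_integral => //.
  - by apply: measurableT_comp => //; case/integrableP: iG.
  - by apply: emeasurable_sum.
  - move=> s _ /=; rewrite sumEFin lee_fin.
    exact: (tent_flux_le (fun p => j s (box_site N p))).
rewrite ge0_integral_sum//; apply: le_trans jC; apply: lee_sum => p _.
exact: ge0_subset_integral.
Qed.

Variables (c : T -> int -> R) (m n N : nat).
Hypotheses (m_gt0 : (0 < m)%N) (n_gt0 : (0 < n)%N) (mn : (m <= n)%N) (nN : (n <= N)%N).

(** [box_average_le] integrated over [I]. The powers of [n] are the prefactor n^-2 and the rescaling
    1/n of [c]; for the constant [Ct], the measure n^2 of [I] cancels the prefactor. *)
Lemma box_time_average_le (Ch Cm Ct : R) :
  mu I = (n%:R ^+ 2)%:E ->
  (forall x, measurable_fun setT (c ^~ x)) ->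
  (\sum_(p < (4 * N).+1) \int[mu]_(s in I)
    `|spatial_increment c s (box_site N p)|%:E <= Ch%:E)%E ->
  (\sum_(p < (4 * N).+1) \int[mu]_(s in I)
    `|averaged_increment c m s (box_site N p)|%:E <= Cm%:E)%E ->
  0 <= Ct ->
  (forall s, I s -> `|tent_average (fun p => c s (box_site N p)) N| <= Ct) ->
  ((n%:R ^+ 2)^-1%:E * \int[mu]_(t in I)
     (((size (box n))%:R)^-1 * \sum_(x <- box n) `|n%:R^-1 * c t x|)%:E <=
   (n%:R ^- 3 * (2 * (m%:R / n%:R) * Ch + Cm) + n%:R^-1 * Ct)%:E)%E.
Proof.
move=> muI mc hCh hCm Ct0 hCt.
have n0 : 0 < n%:R :> R by rewrite ltr0n.
have N0 : (0 < N)%N by exact: leq_trans nN.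
have mabs f x : (forall x, measurable_fun setT (f ^~ x)) ->
    measurable_fun I (fun s => `|f s x : R|%:E).
  move=> mf; apply/measurable_EFinP; apply: measurable_funTS; exact: measurableT_comp.
have mh x : measurable_fun setT ((spatial_increment c) ^~ x).
  by apply: measurable_funB; exact: mc.
have mm x : measurable_fun setT ((averaged_increment c m) ^~ x).
  by apply: measurable_funM => //; apply: measurable_sum => k; exact: mh.
pose al := n%:R^-1 * (2 * (m%:R / n%:R)) : R.
pose ga := n%:R^-1 * Ct.
have al0 : 0 <= al by rewrite !mulr_ge0// ?invr_ge0.
have ga0 : 0 <= ga by rewrite mulr_ge0 ?invr_ge0.
pose U1 t := (al%:E * (\sum_(p < (4 * N).+1) `|spatial_increment c t (box_site N p)|%:E))%E.
pose U2 t := (n%:R^-1%:E * (\sum_(p < (4 * N).+1) `|averaged_increment c m t (box_site N p)|%:E))%E.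
have pointwise t : I t ->
   ((((size (box n))%:R)^-1 * \sum_(x <- box n) `|n%:R^-1 * c t x|)%:E <=
      U1 t + U2 t + ga%:E)%E.
  move=> It; have tc := hCt t It.
  rewrite /U1 /U2 !sumEFin -!EFinM -!EFinD lee_fin.
  have -> : size (box n) = n.*2.+1 by rewrite size_map size_iota.
  have -> : \sum_(x <- box n) `|n%:R^-1 * c t x| =
      n%:R^-1 * \sum_(k < n.*2.+1) `|c t (box_site N (2 * N - n + k)%N)|.
    rewrite big_map mulr_sumr.
    rewrite -(big_mkord xpredT (fun k => n%:R^-1 * `|c t (box_site N (2 * N - n + k)%N)|)).
    rewrite /index_iota subn0; apply: eq_bigr => k _.
    rewrite normrM gtr0_norm ?invr_gt0//; congr (_ * `|c t _|).
    by rewrite /box_site; move: nN; clear; lia.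
  have := @box_average_le R (fun p => c t (box_site N p)) m m_gt0 N n n_gt0 nN (leq_trans mn nN).
  have dE z : c t (box_site N z.+1) - c t (box_site N z) = spatial_increment c t (box_site N z).
    by rewrite /spatial_increment; congr (c t _ - _); rewrite /box_site; clear; lia.
  under [X in _ <= _ * X + _ + _]eq_bigr do rewrite dE.
  under [X in _ <= _ + X + _]eq_bigr => z _.
    have -> : m%:R^-1 * (\sum_(k < m) (c t (box_site N (z + k).+1) - c t (box_site N (z + k)%N))) =
        averaged_increment c m t (box_site N z).
      rewrite /averaged_increment; congr (_ * _); apply: eq_bigr => k _.
      by rewrite dE; congr (spatial_increment c t); rewrite /box_site; clear; lia.
    over.
  move=> h; rewrite mulrCA /al /ga -!mulrA -!mulrDr ler_pM2l ?invr_gt0//.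
  apply: le_trans h _; rewrite -!mulrA; exact: lerD.
have mU1 : measurable_fun I U1.
  by apply: emeasurable_funM => //; apply: emeasurable_sum => p; exact: mabs.
have mU2 : measurable_fun I U2.
  by apply: emeasurable_funM => //; apply: emeasurable_sum => p; exact: mabs.
have U10 t : I t -> (0 <= U1 t)%E.
  by move=> _; apply: mule_ge0; [rewrite lee_fin|apply: sume_ge0].
have U20 t : I t -> (0 <= U2 t)%E.
  by move=> _; apply: mule_ge0; [rewrite lee_fin invr_ge0|apply: sume_ge0].
have le1 : (\int[mu]_(t in I)
     (((size (box n))%:R)^-1 * \sum_(x <- box n) `|n%:R^-1 * c t x|)%:E <=
     \int[mu]_(t in I) (U1 t + U2 t + ga%:E))%E.
  apply: ge0_le_integral => //.
  - by move=> t _; rewrite lee_fin mulr_ge0 ?invr_ge0// sumr_ge0.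
  - apply/measurable_EFinP; apply: measurable_funM => //; apply: measurable_sum => x.
    apply: measurable_funTS; apply: measurableT_comp => //.
    by apply: measurable_funM.
  - by apply: emeasurable_funD => //; apply: emeasurable_funD.
have le2 : (\int[mu]_(t in I) (U1 t + U2 t + ga%:E) <=
    (al * Ch + n%:R^-1 * Cm + ga * n%:R ^+ 2)%:E)%E.
  rewrite ge0_integralD//; last 2 first.
  - by move=> t It; apply: adde_ge0; [exact: U10|exact: U20].
  - by apply: emeasurable_funD.
  rewrite ge0_integralD// integral_cst// muI EFinD EFinM.
  apply: leeD => //; rewrite EFinD; apply: leeD; rewrite EFinM.
    rewrite ge0_integralZl//; last 2 first.
    - by apply: emeasurable_sum => p; exact: mabs.
    - by move=> t _; apply: sume_ge0.
    apply: lee_wpmul2l; first by rewrite lee_fin.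
    by rewrite ge0_integral_sum// => p; exact: mabs.
  rewrite ge0_integralZl//; last 2 first.
  - by apply: emeasurable_sum => p; exact: mabs.
  - by move=> t _; apply: sume_ge0.
  apply: lee_wpmul2l; first by rewrite lee_fin invr_ge0.
  by rewrite ge0_integral_sum// => p; exact: mabs.
apply: (@le_trans _ _ ((n%:R ^+ 2)^-1%:E * (al * Ch + n%:R^-1 * Cm + ga * n%:R ^+ 2)%:E)%E).
  apply: lee_wpmul2l; first by rewrite lee_fin invr_ge0 exprn_ge0.
  exact: le_trans le1 le2.
rewrite -EFinM lee_fin /al /ga le_eqVlt; apply/orP; left; apply/eqP; field.
by rewrite gt_eqF.
Qed.

End time_slices.

Lemma ge0_integral_cover_le d (T : measurableType d) (R : realType)
    (mu : {measure set T -> \bar R}) (f : T -> \bar R) (D E : nat -> set T) :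
  measurable_fun setT f -> (forall x, (0 <= f x)%E) ->
  (forall i, measurable (D i)) -> (forall i, measurable (E i)) ->
  E 0%N `<=` D 0%N -> (forall i, E i.+1 `<=` E i `|` D i.+1) ->
  forall k, (\int[mu]_(x in E k) f x <= \sum_(i < k.+1) \int[mu]_(x in D i) f x)%E.
Proof.
move=> mf f0 mD mE E0 ES; elim => [|k IH].
  by rewrite big_ord1; apply: ge0_subset_integral => //; exact: measurable_funTS.
rewrite big_ord_recr/=; apply: le_trans (leeD IH (lexx _)).
apply: (@le_trans _ _ (\int[mu]_(x in E k `|` (D k.+1 `\` E k)) f x)%E).
  apply: ge0_subset_integral => //.
  - by apply: measurableU => //; exact: measurableD.
  - exact: measurable_funTS.
  - by rewrite setUDr setDv setD0.
rewrite ge0_integral_setU//.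
- apply: leeD => //; apply: ge0_subset_integral => //.
  + exact: measurableD.
  + exact: measurable_funTS.
- exact: measurableD.
- exact: measurable_funTS.
- by apply/disj_setPLR => x Ex [].
Qed.

(** [A] need not be measurable: it will be the event that a bound fails for infinitely many [n]. *)
Lemma negligible_small d (T : measurableType d) (R : realType)
    (mu : {measure set T -> \bar R}) (A : set T) :
  (forall eta : R, 0 < eta -> exists B, [/\ measurable B, (mu B <= eta%:E)%E & A `<=` B]) ->
  mu.-negligible A.
Proof.
move=> h.
have /choice[B hB] : forall k : nat, exists B, [/\ measurable B, (mu B <= k.+1%:R^-1%:E)%E & A `<=` B].
  by move=> k; apply: h; rewrite invr_gt0.
have mB : measurable (\bigcap_k B k) by apply: bigcapT_measurable => k; case: (hB k).
exists (\bigcap_k B k); split => //; last by move=> x Ax k _; case: (hB k) => _ _; exact.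
apply/eqP; rewrite -measure_le0; apply/lee_addgt0Pr => e e0; rewrite add0e.
have [k _ hk] := near_infty_natSinv_lt (PosNum e0).
have [mBk Bk _] := hB k.
apply: (@le_trans _ _ (mu (B k))).
  by apply: le_measure; rewrite ?inE//; exact: bigcap_inf.
by apply: (le_trans Bk); rewrite lee_fin; apply/ltW/hk => /=.
Qed.

Lemma ge0_cvg0 (R : realType) (u : nat -> \bar R) : (forall n, (0 <= u n)%E) ->
  (forall k : nat, \forall n \near \oo, (u n <= k.+1%:R^-1%:E)%E) -> u @ \oo --> 0%E.
Proof.
move=> u0 hu A /= [e /= e0 eA].
have [k _ hk] := near_infty_natSinv_lt (PosNum e0).
have {}hk := hk k (leqnn k).
suff : \forall n \near \oo, A (u n) by [].
near=> n.
have : (u n <= k.+1%:R^-1%:E)%E by near: n; exact: hu.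
move: (u0 n); case: (u n) => [r| |]//; rewrite !lee_fin => r0 rk.
by apply: eA; rewrite /ball_ /= sub0r normrN ger0_norm// (le_lt_trans rk).
Unshelve. all: by end_near. Qed.

Section sublinearity.
Variables (R : realType) (P : probability (Omega R) R) (Phi0 : Omega R -> int -> R).
Hypotheses (P_measurable : jointly_measurable P) (P_stationary : stationary P).
Hypotheses (P_moments : finite_moments P) (Phi0_corrector : is_corrector_field P Phi0).

Local Notation err := (gradient_error Phi0).
Local Notation aerr := (average_error Phi0).
Local Notation flx := (flux Phi0).

Lemma flow_gradient_error : has_measurable_flow P (fun w => `|err w|).
Proof.
apply: has_measurable_flow_norm.
apply: continuous_has_measurable_flow; first exact: measurable_gradient_error Phi0_corrector.
apply: ae_mono (ae_regular_env P_stationary Phi0_corrector) _ => w [cw _] s.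
by apply: cvgB; [exact: cvg_cst|exact: cw].
Qed.

Lemma flow_average_error m : has_measurable_flow P (fun w => `|aerr m w|).
Proof.
apply: has_measurable_flow_norm.
apply: continuous_has_measurable_flow; first exact: measurable_average_error Phi0_corrector m.
apply: ae_mono (ae_regular_env P_stationary Phi0_corrector) _ => w [cw coc].
(* By the cocycle identity the sum telescopes, so the path is a combination of two continuous paths
   of [Phi0]. *)
have -> : (fun s : R => aerr m (tau s 0 w)) = (fun s => m%:R^-1 *
    (m%:R - (Phi0 (tau s 0 w) m%:Z - Phi0 (tau s 0 w) 0))).
  apply/funext => s; rewrite /average_error; congr (_ * _).
  have := @telescope_sumr _ 0 m (fun k => Phi0 (tau s 0 w) k%:Z) (leq0n m).
  rewrite big_mkord => <-.
  rewrite (_ : m%:R = \sum_(k < m) (1 : R)); last by rewrite sumr_const card_ord.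
  rewrite -sumrB; apply: eq_bigr => k _.
  rewrite tau_tau addr0 add0r /gradient_error.
  have -> : (k.+1%:Z = k%:Z + 1)%R by rewrite -addn1.
  by rewrite -coc addrAC subrr add0r.
move=> s; apply: cvgM; first exact: cvg_cst.
by apply: cvgB; [exact: cvg_cst|apply: cvgB; exact: cw].
Qed.

(** The weight has no continuity in time, so its factor relies on the joint measurability
    hypothesis; the [Phi0] factor has continuous paths. *)
Lemma has_measurable_flow_flux : has_measurable_flow P flx.
Proof.
apply: has_measurable_flowM; first exact: has_measurable_flow_weight.
have [[mPhi _ _] _ _] := Phi0_corrector.
apply: continuous_has_measurable_flow => //.
by apply: ae_mono (ae_regular_env P_stationary Phi0_corrector) _ => w [cw _]; exact: cw.
Qed.

(** Consecutive unit intervals share end points, hence a covering bound in place of an identity; an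
    upper bound is all that the maximal inequality needs. *)
Lemma time_majorant (q : Omega R -> R) : measurable_fun setT q -> (forall w, 0 <= q w) ->
  has_measurable_flow P q ->
  exists F : Omega R -> \bar R,
  [/\ measurable_fun setT F, forall w, (0 <= F w)%E,
      (\int[P]_w F w = \int[P]_w (q w)%:E)%E
    & {ae P, forall w, forall (x : int) (M : nat),
        (\int[leb R]_(s in `[0%R, M.+1%:R]) (q (tau s x w))%:E <=
          \sum_(i < M.+1) F (tau i%:R x w))%E}].
Proof.
move=> mq q0 fq; have [F [mF F0 EF aeF]] := time_average P_stationary mq q0 fq.
exists F; split => //.
have := ae_forall_countable (fun x : int => ae_tau P_stationary 0 x aeF).
move=> h; apply: ae_mono h _ => w hw x M.
have [ms hk] := hw x.
have tE s : tau s 0 (tau 0 x w) = tau s x w by rewrite tau_tau add0r addr0.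
have {}ms : measurable_fun (setT : set (lebT R)) (fun s => q (tau s x w)).
  by move: ms; under eq_fun do rewrite tE.
rewrite (eq_bigr (fun i : 'I_M.+1 =>
   \int[leb R]_(s in `[(i : nat)%:R, ((i : nat)%:R + 1)%R]) (q (tau s x w))%:E)%E); last first.
  by move=> i _; rewrite -tE -hk; under eq_integral do rewrite tE.
apply: (@ge0_integral_cover_le _ (lebT R) R (leb R) (fun s => (q (tau s x w))%:E)
  (fun i => `[i%:R, (i%:R + 1)]%classic) (fun i => `[0, i.+1%:R]%classic)).
- exact/measurable_EFinP.
- by move=> s; rewrite lee_fin.
- by move=> i; apply: measurable_leb; exact: measurable_itv.
- by move=> i; apply: measurable_leb; exact: measurable_itv.
- by rewrite add0r.
- move=> i s /=; rewrite !in_itv/= => /andP[s0 si].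
  case: (leP s i.+1%:R) => h; [left|right]; rewrite ?s0//.
  by rewrite (ltW h) natr1.
Qed.

Lemma maximal_small (F : Omega R -> \bar R) (a b : nat -> nat) (c eta : R) :
  measurable_fun setT F -> (forall w, (0 <= F w)%E) ->
  (forall n, (0 < a n)%N) -> {homo a : m n / (m <= n)%N} -> {homo b : m n / (m <= n)%N} ->
  0 < c -> (16%:E * \int[P]_w F w <= (c * eta)%:E)%E ->
  exists B, [/\ measurable B, (P B <= eta%:E)%E & forall w, ~ B w -> forall n,
    (box_sum F a b n w <= (c * (a n * (b n).*2.+1)%:R)%:E)%E].
Proof.
move=> mF F0 a0 ha hb c0 hc.
have [mB hB] := maximal_inequality P_stationary mF F0 a0 ha hb c0.
exists (\bigcup_n exceeds F a b c n); split => //.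
- have h16 : (0%R < 16%:E :> \bar R)%E by rewrite lte_fin.
  have := lee_wpmul2l (ltW h16) hB => /le_trans/(_ hc).
  rewrite -(fineK (fin_num_measure P _ mB)) -!EFinM !lee_fin.
  have -> : 16 * (c / 16 * fine (P (\bigcup_n exceeds F a b c n))) =
     c * fine (P (\bigcup_n exceeds F a b c n)) by field.
  by rewrite ler_pM2l.
- by move=> w Bw n; rewrite leNgt; apply/negP => h; apply: Bw; exists n.
Qed.

Definition mean_corrector (n : nat) (w : Omega R) : \bar R :=
  ((n%:R ^+ 2)^-1%:E *
       \int[leb R]_(t in `[0%R, (n%:R ^+ 2)%R])
         (((size (box n))%:R)^-1 *
            \sum_(x <- box n) `|n%:R^-1 * corrector Phi0 w t x|)%:E)%E.

End sublinearity.

(** * Deterministic estimate along one environment *)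

Section pathwise.
Variables (R : realType) (Phi0 : Omega R -> int -> R) (w : Omega R).
Local Notation err := (gradient_error Phi0).
Local Notation aerr := (average_error Phi0).
Local Notation flx := (flux Phi0).

Hypothesis regular_w : regular_env Phi0 w.
Hypothesis continuous_corrector : forall x, continuous (fun t => corrector Phi0 w t x).
Hypothesis corrector00 : corrector Phi0 w 0 0 = 0.
Hypothesis dynamics_w : forall (x : int) (t : R), 0 <= t ->
  (leb R).-integrable `[0, t] (fun s => (flx (tau s x w) - flx (tau s (x - 1) w))%:E) /\
  corrector Phi0 w t x - corrector Phi0 w 0 x =
    \int[leb R]_(s in `[0, t]) (flx (tau s x w) - flx (tau s (x - 1) w)).
Hypothesis measurable_flow_flux : forall x,
  measurable_fun (setT : set (lebT R)) (fun s => flx (tau s x w)).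

Variables (m K : nat) (ch cm cj : R).
Hypotheses (m_gt0 : (0 < m)%N) (K_gt0 : (0 < K)%N).
Hypotheses (ch0 : 0 <= ch) (cm0 : 0 <= cm) (cj0 : 0 <= cj).

Let b0 : R := \sum_(k < m) `|err (tau 0 k%:Z w)|.

Variable n : nat.
Hypotheses (n_gt0 : (0 < n)%N) (mn : (m <= n)%N).
Let N := (K * n)%N.
Let I : set R := `[0, n%:R ^+ 2]%classic.
Hypothesis err_bound : (\sum_(p < (4 * N).+1) \int[leb R]_(s in I)
  `|err (tau s (box_site N p) w)|%:E <= (ch * (n ^ 2 * (4 * N).+1)%:R)%:E)%E.
Hypothesis aerr_bound : (\sum_(p < (4 * N).+1) \int[leb R]_(s in I)
  `|aerr m (tau s (box_site N p) w)|%:E <= (cm * (n ^ 2 * (4 * N).+1)%:R)%:E)%E.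
Hypothesis flux_bound : (\sum_(p < (4 * N).+1) \int[leb R]_(s in I)
  `|flx (tau s (box_site N p) w)|%:E <= (cj * (n ^ 2 * (4 * N).+1)%:R)%:E)%E.
Hypothesis err_bound0 : \sum_(p < (4 * N).+1) `|err (tau 0 (box_site N p) w)| <=
  ch * (4 * N).+1%:R.
Hypothesis aerr_bound0 : \sum_(p < (4 * N).+1) `|aerr m (tau 0 (box_site N p) w)| <=
  cm * (4 * N).+1%:R.

Let n0 : 0 < n%:R :> R. Proof. by rewrite ltr0n. Qed.
Let K0 : 0 < K%:R :> R. Proof. by rewrite ltr0n. Qed.
Let N_gt0 : (0 < N)%N. Proof. by rewrite muln_gt0 K_gt0 n_gt0. Qed.
Let nN : (n <= N)%N. Proof. by rewrite leq_pmull. Qed.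

Let incE s p : corrector Phi0 w s (box_site N p.+1) - corrector Phi0 w s (box_site N p) =
  err (tau s (box_site N p) w).
Proof.
rewrite -(corrector_increment _ _ regular_w); congr (corrector Phi0 w s _ - _).
by rewrite /box_site; clear; lia.
Qed.

Let aincE s x : averaged_increment (fun s : R => corrector Phi0 w s) m s x = aerr m (tau s x w).
Proof.
rewrite /averaged_increment /average_error; congr (_ * _); apply: eq_bigr => k _.
by rewrite /spatial_increment corrector_increment// tau_tau addr0.
Qed.

(** The corrector vanishes at the origin at time 0, so its tent average is controlled by increments
    at time 0 alone. The local term [b0] does not depend on [n]. *)
Let tent0 : `|tent_average (fun p => corrector Phi0 w 0 (box_site N p)) N| <=
  b0 + m%:R / N%:R * (ch * (4 * N).+1%:R) + cm * (4 * N).+1%:R.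
Proof.
have := @tent_average_le R (fun p => corrector Phi0 w 0 (box_site N p)) m m_gt0 N N_gt0
  (leq_trans mn nN).
move/le_trans; apply.
rewrite (_ : box_site N (2 * N) = 0); last by rewrite /box_site subrr.
rewrite corrector00 normr0 add0r; apply: lerD; first apply: lerD.
- rewrite /b0; apply: ler_sum => k _; rewrite incE.
  by rewrite (_ : box_site N (2 * N + k) = k%:Z)// /box_site; clear; lia.
- apply: ler_wpM2l; first by rewrite divr_ge0.
  by under eq_bigr do rewrite incE.
- apply: (le_trans _ aerr_bound0); apply: ler_sum => p _.
  rewrite -aincE /averaged_increment le_eqVlt; apply/orP; left; apply/eqP; congr `|_ * _|.
  apply: eq_bigr => k _; rewrite incE /spatial_increment corrector_increment//.
  by congr (err (tau 0 _ w)); rewrite /box_site; clear; lia.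
Qed.

(** The tent average at time [s] is its value at time 0 plus a flux integral. The constants come
    from [4 N + 1 <= 5 K n]: [cm] occurs twice, in the box comparison and at time 0, whence 10, and
    the flux gives N^-2 n^2 (5 K n) / n = 5 / K. *)
Lemma mean_corrector_le : (mean_corrector Phi0 n w <=
  ((10 * m%:R * K%:R * ch + 5 * m%:R * ch + b0) / n%:R + 10 * K%:R * cm + 5 * cj / K%:R)%:E)%E.
Proof.
have mc x : measurable_fun (setT : set (lebT R)) (fun s => corrector Phi0 w s x).
  apply: measurable_fun_leb; last exact: measurableT.
  exact: continuous_measurable_fun.
have mI t : measurable (`[0, t] : set (lebT R)).
  by apply: measurable_leb; exact: measurable_itv.
have muI : leb R I = (n%:R ^+ 2)%:E.
  have : @lebesgue_measure R I = (n%:R ^+ 2)%:E.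
    by rewrite lebesgue_measure_itv/= lte_fin exprn_gt0// oppr0 adde0.
  by [].
set S : R := (4 * N).+1%:R.
have S0 : 0 <= S by [].
pose Ct := b0 + m%:R / N%:R * (ch * S) + cm * S + (N%:R ^+ 2)^-1 * (cj * (n ^ 2 * (4 * N).+1)%:R).
have b00 : 0 <= b0 by exact: sumr_ge0.
have Ct0 : 0 <= Ct.
  by rewrite /Ct !addr_ge0 ?mulr_ge0 ?invr_ge0 ?exprn_ge0.
have hCt s : I s -> `|tent_average (fun p => corrector Phi0 w s (box_site N p)) N| <= Ct.
  rewrite /I/= in_itv/= => /andP[s0 sn].
  rewrite -[X in `|X|](subrK (tent_average (fun p => corrector Phi0 w 0 (box_site N p)) N)) addrC.
  apply: le_trans (ler_normD _ _) _; apply: lerD; first exact: tent0.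
  have -> : tent_average (fun p => corrector Phi0 w s (box_site N p)) N -
      tent_average (fun p => corrector Phi0 w 0 (box_site N p)) N =
      tent_average (fun p => (fun x => corrector Phi0 w s x - corrector Phi0 w 0 x) (box_site N p)) N.
    rewrite /tent_average -mulrBr -sumrB; congr (_ * _).
    by apply: eq_bigr => a _; rewrite -sumrB.
  apply: (@tent_flux_integral_le _ (lebT R) R (leb R) I (mI _)
    (fun s x => flx (tau s x w)) `[0, s]%classic
    (fun x => corrector Phi0 w s x - corrector Phi0 w 0 x) N
    (cj * (n ^ 2 * (4 * N).+1)%:R) (mI s)) => //.
  - by apply: subset_itvl; rewrite bnd_simp.
  - by move=> x; exact: dynamics_w.
have := @box_time_average_le _ (lebT R) R (leb R) I (mI _) (fun s : R => corrector Phi0 w s)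
  m n N m_gt0 n_gt0 mn nN (ch * (n ^ 2 * (4 * N).+1)%:R) (cm * (n ^ 2 * (4 * N).+1)%:R) Ct
  muI mc _ _ Ct0 hCt.
move=> h; apply: le_trans (h _ _) _.
- apply: (le_trans _ err_bound); apply: lee_sum => p _.
  rewrite le_eqVlt; apply/orP; left; apply/eqP; apply: eq_integral => s _.
  by rewrite /spatial_increment corrector_increment.
- apply: (le_trans _ aerr_bound); apply: lee_sum => p _.
  rewrite le_eqVlt; apply/orP; left; apply/eqP; apply: eq_integral => s _.
  by rewrite aincE.
rewrite lee_fin /Ct natrM natrX -/S /N natrM.
have S5 : S <= 5 * (K%:R * n%:R).
  have : ((4 * N).+1 <= 5 * (K * n))%N by move: N_gt0; rewrite /N; clear; lia.
  by rewrite -(ler_nat R) !natrM.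
pose Q := 2 * m%:R * ch / n%:R ^+ 2 + cm / n%:R + m%:R * ch / (K%:R * n%:R ^+ 2)
   + cm / n%:R + cj / (K%:R ^+ 2 * n%:R) : R.
have Q0 : 0 <= Q by rewrite /Q !addr_ge0// ?mulr_ge0// ?invr_ge0 ?mulr_ge0 ?exprn_ge0.
apply: (@le_trans _ _ (S * Q + b0 / n%:R)).
  rewrite /Q le_eqVlt; apply/orP; left; apply/eqP; field.
  by rewrite !gt_eqF.
apply: (@le_trans _ _ (5 * (K%:R * n%:R) * Q + b0 / n%:R)).
  by rewrite lerD2r; exact: ler_wpM2r.
rewrite /Q le_eqVlt; apply/orP; left; apply/eqP; field.
by rewrite !gt_eqF.
Qed.

End pathwise.

(** * Sublinearity *)

(** Boxes are indexed by [n - 1], so that every box is nonempty in time: index [n - 1] is the box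
    with [n^2] times and places from [- 2 K n] to [2 K n]. *)
Lemma box_integral_le (R : realType) (q : Omega R -> R) (F : Omega R -> \bar R)
    (w : Omega R) (c : R) (K n : nat) : (0 < n)%N ->
  (forall (x : int) (M : nat), (\int[leb R]_(s in `[0%R, M.+1%:R]) (q (tau s x w))%:E <=
     \sum_(i < M.+1) F (tau i%:R x w))%E) ->
  (forall n', (box_sum F (fun i => i.+1 ^ 2)%N (fun i => 2 * (K * i.+1))%N n' w <=
     (c * (n'.+1 ^ 2 * (2 * (K * n'.+1)).*2.+1)%:R)%:E)%E) ->
  (\sum_(p < (4 * (K * n)).+1) \int[leb R]_(s in `[0%R, (n%:R ^+ 2)%R])
     (q (tau s (box_site (K * n) p) w))%:E <= (c * (n ^ 2 * (4 * (K * n)).+1)%:R)%:E)%E.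
Proof.
case: n => // n' _ maj /(_ n').
set N := (K * n'.+1)%N.
have -> : (2 * N).*2 = (4 * N)%N by lia.
apply: le_trans; rewrite /box_sum.
have -> : ((2 * (K * n'.+1)).*2 = 4 * N)%N by rewrite /N; lia.
rewrite exchange_big/=; apply: lee_sum => p _.
have sqE : (n'.+1 ^ 2 = (n'.+1 ^ 2).-1.+1)%N by rewrite prednK// expn_gt0.
have := maj (box_site N p) (n'.+1 ^ 2).-1.
by rewrite -sqE natrX.
Qed.

Lemma box_sum_le (R : realType) (q : Omega R -> R) (w : Omega R) (c : R) (K n : nat) :
  (0 < n)%N ->
  (forall n', (box_sum (EFin \o q) (fun=> 1%N) (fun i => 2 * (K * i.+1))%N n' w <=
     (c * (1 * (2 * (K * n'.+1)).*2.+1)%:R)%:E)%E) ->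
  \sum_(p < (4 * (K * n)).+1) q (tau 0 (box_site (K * n) p) w) <= c * (4 * (K * n)).+1%:R.
Proof.
case: n => // n' _ /(_ n').
set N := (K * n'.+1)%N.
have -> : (2 * N).*2 = (4 * N)%N by lia.
rewrite mul1n -lee_fin; apply: le_trans; rewrite /box_sum.
have -> : ((2 * (K * n'.+1)).*2 = 4 * N)%N by rewrite /N; lia.
by rewrite big_ord1 -sumEFin.
Qed.

Lemma measurable_flow (R : realType) (P : probability (Omega R) R) (q : Omega R -> R) :
  stationary P -> has_measurable_flow P q ->
  {ae P, forall w, forall x : int,
     measurable_fun (setT : set (lebT R)) (fun s => q (tau s x w))}.
Proof.
move=> P_stationary [q' [mq' qq']].
have qq2 : {ae (@lebesgue_measure R \x P)%E, forall p, q (tau p.1 0 p.2) = q' (p.1, p.2)}.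
  by apply: ae_mono qq' _ => -[].
have [_ hw] := @ae_product _ _ _ _ _ (@lebesgue_measure R) P
  (fun s w => q (tau s 0 w) = q' (s, w)) qq2.
have h0 : {ae P, forall w, measurable_fun (setT : set (lebT R)) (fun s => q (tau s 0 w))}.
  apply: ae_mono hw _ => w hw.
  apply: ae_eq_leb_measurable hw; exact: measurableT_comp.
apply: ae_mono (ae_forall_countable (fun x : int => ae_tau P_stationary 0 x h0)) _.
move=> w h x; move: (h x).
by under eq_fun do rewrite tau_tau add0r addr0.
Qed.

Section conclusion.
Variables (R : realType) (P : probability (Omega R) R) (Phi0 : Omega R -> int -> R).
Hypotheses (P_measurable : jointly_measurable P) (P_stationary : stationary P).
Hypotheses (P_moments : finite_moments P) (Phi0_corrector : is_corrector_field P Phi0).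

(** The three contributions of [mean_corrector_le] get [delta / 4] for the flux, [delta / 4] for the
    averaged error and [delta / 2] for the part of order 1/n. *)
Lemma mean_corrector_small (delta eta : R) : 0 < delta -> 0 < eta ->
  exists B, [/\ measurable B, (P B <= eta%:E)%E &
    {ae P, forall w, ~ B w -> \forall n \near \oo, (mean_corrector Phi0 n w <= delta%:E)%E}].
Proof.
move=> delta0 eta0.
(* One fifth for each of the exceptional sets [B1] to [B5]. *)
pose e := eta / 5; have e0 : 0 < e by rewrite divr_gt0.
pose qh w := `|gradient_error Phi0 w|; pose qj w := `|flux Phi0 w|.
have mqh : measurable_fun setT qh.
  by apply: measurableT_comp => //; exact: measurable_gradient_error Phi0_corrector.
have mqj : measurable_fun setT qj.
  by apply: measurableT_comp => //; exact: measurable_flux Phi0_corrector.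
have constant (q : Omega R -> R) : (forall w, 0 <= q w) -> (\int[P]_w (q w)%:E < +oo)%E ->
    exists2 c, 0 < c & (16%:E * \int[P]_w (q w)%:E <= (c * e)%:E)%E.
  move=> q0 iq.
  have i0 : (0 <= \int[P]_w (q w)%:E)%E by apply: integral_ge0 => w _; rewrite lee_fin.
  have iE : (\int[P]_w (q w)%:E = (fine (\int[P]_w (q w)%:E))%:E)%E.
    by rewrite fineK// ge0_fin_numE.
  have f0 := fine_ge0 i0.
  exists (16 * (fine (\int[P]_w (q w)%:E)%E + 1) / e).
    by rewrite divr_gt0// mulr_gt0// ltr_wpDl.
  by rewrite iE -EFinM lee_fin divfK ?gt_eqF// ler_pM2l// lerDl.
have [ch ch0 hch] := constant qh (fun w => normr_ge0 _)
  (integral_gradient_error_lty P_moments Phi0_corrector).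
have [cj cj0 hcj] := constant qj (fun w => normr_ge0 _)
  (integral_flux_lty P_moments Phi0_corrector).
pose K := (Num.bound (20 * cj / delta)).+1.
have K0 : 0 < K%:R :> R by rewrite ltr0n.
have cjK : 5 * cj / K%:R <= delta / 4.
  have : 20 * cj / delta < K%:R.
    apply: (lt_le_trans (archi_boundP _)); last by rewrite ler_nat.
    by rewrite !divr_ge0// ?mulr_ge0// ltW.
  rewrite ltr_pdivrMr// ler_pdivrMr// => h; lra.
(* [cm] has to absorb the factor [10 * K]; [K] came from [cj] and [delta] alone, and only now is [m]
   chosen to reach this level. *)
pose cm := delta / (40 * K%:R); have cm0 : 0 < cm by rewrite divr_gt0// mulr_gt0.
have cmK : 10 * K%:R * cm = delta / 4 by rewrite /cm; field; rewrite gt_eqF.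
have [m m0 hm] : exists2 m, (0 < m)%N &
    (\int[P]_w `|average_error Phi0 m w|%:E <= (cm * e / 16)%:E)%E.
  by apply: (average_error_small P_stationary P_moments Phi0_corrector); rewrite !divr_gt0// mulr_gt0.
pose qm w := `|average_error Phi0 m w|.
have mqm : measurable_fun setT qm.
  by apply: measurableT_comp => //; exact: measurable_average_error Phi0_corrector m.
have hcm : (16%:E * \int[P]_w (qm w)%:E <= (cm * e)%:E)%E.
  have -> : cm * e = 16 * (cm * e / 16) by field.
  by rewrite EFinM; apply: lee_wpmul2l.
have [Fh [mFh Fh0 EFh majh]] := time_majorant P_stationary mqh (fun w => normr_ge0 _)
  (flow_gradient_error P_stationary Phi0_corrector).
have [Fm [mFm Fm0 EFm majm]] := time_majorant P_stationary mqm (fun w => normr_ge0 _)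
  (flow_average_error P_stationary Phi0_corrector m).
have [Fj [mFj Fj0 EFj majj]] := time_majorant P_stationary mqj (fun w => normr_ge0 _)
  (has_measurable_flow_norm (has_measurable_flow_flux P_measurable P_stationary Phi0_corrector)).
pose a1 (i : nat) := (i.+1 ^ 2)%N; pose b (i : nat) := (2 * (K * i.+1))%N.
have a10 i : (0 < a1 i)%N by rewrite expn_gt0.
have a1h : {homo a1 : i j / (i <= j)%N} by move=> i j ij; rewrite leq_exp2r.
have bh : {homo b : i j / (i <= j)%N}.
  by move=> i j ij; rewrite leq_mul2l leq_mul2l ltnS ij !orbT.
have a0h : {homo (fun _ : nat => 1%N) : i j / (i <= j)%N} by [].
have ms F := @maximal_small R P P_stationary F.
(* [B1] to [B3] serve the space-time boxes; [B4] and [B5] come from boxes with a single time and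
   serve the initial tent average. *)
have [B1 [mB1 PB1 hB1]] := ms Fh a1 b ch e mFh Fh0 a10 a1h bh ch0 ltac:(by rewrite EFh).
have [B2 [mB2 PB2 hB2]] := ms Fm a1 b cm e mFm Fm0 a10 a1h bh cm0 ltac:(by rewrite EFm).
have [B3 [mB3 PB3 hB3]] := ms Fj a1 b cj e mFj Fj0 a10 a1h bh cj0 ltac:(by rewrite EFj).
have mE (q : Omega R -> R) : measurable_fun setT q -> measurable_fun setT (EFin \o q).
  by move=> ?; exact/measurable_EFinP.
have abs0 (q : Omega R -> R) w : (0 <= (EFin \o (fun v => `|q v|%R)) w)%E.
  by rewrite /= lee_fin.
have [B4 [mB4 PB4 hB4]] := ms (EFin \o qh) (fun=> 1%N) b ch e (mE _ mqh)
  (abs0 _) (fun=> isT) a0h bh ch0 hch.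
have [B5 [mB5 PB5 hB5]] := ms (EFin \o qm) (fun=> 1%N) b cm e (mE _ mqm)
  (abs0 _) (fun=> isT) a0h bh cm0 hcm.
exists (B1 `|` (B2 `|` (B3 `|` (B4 `|` B5)))); split.
- by do !apply: measurableU.
- have -> : eta%:E = (e%:E + (e%:E + (e%:E + (e%:E + e%:E))))%E.
    by rewrite -!EFinD; congr EFin; rewrite /e; field.
  do 3! (apply: le_trans (measureU2 _ _ _) _; [by []|by do ?apply: measurableU|apply: leeD => //]).
  by apply: le_trans (measureU2 _ _ _) _ => //; apply: leeD.
have [_ _ good] := Phi0_corrector.
have reg := ae_regular_env P_stationary Phi0_corrector.
have dyn := ae_dynamics P_stationary Phi0_corrector.
have mfl := measurable_flow P_stationary
  (has_measurable_flow_flux P_measurable P_stationary Phi0_corrector).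
apply: (@negligibleS _ _ _ _ _ _ _ (negligibleU majh (negligibleU majm (negligibleU majj
  (negligibleU good (negligibleU reg (negligibleU dyn mfl))))))).
move=> w /= h; apply: contrapT.
move=> /not_orP[/contrapT {}majh /not_orP[/contrapT {}majm /not_orP[/contrapT {}majj
  /not_orP[/contrapT {}good /not_orP[/contrapT {}reg /not_orP[/contrapT {}dyn /contrapT {}mfl]]]]]].
apply: h => /not_orP[nB1 /not_orP[nB2 /not_orP[nB3 /not_orP[nB4 nB5]]]].
have [_ [acw _] h00] := good.
pose b0 : R := \sum_(k < m) `|gradient_error Phi0 (tau 0 k%:Z w)|.
pose X := 10 * m%:R * K%:R * ch + 5 * m%:R * ch + b0.
near=> n.
have mn : (m <= n)%N by near: n; exact: nbhs_infty_ge.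
have n0 : (0 < n)%N by exact: leq_trans mn.
have n0R : 0 < n%:R :> R by rewrite ltr0n.
apply: le_trans (@mean_corrector_le R Phi0 w reg _ _ dyn mfl m K ch cm cj m0 _ _ _ _ n n0 mn
  _ _ _ _ _) _.
- by move=> x t; apply: cvgB; [exact: cvg_cst|exact: locally_abs_continuous_continuous (acw x) t].
- by rewrite /corrector h00 subr0.
- by [].
- exact: ltW.
- exact: ltW.
- exact: ltW.
- exact: box_integral_le n0 majh (hB1 w nB1).
- exact: box_integral_le n0 majm (hB2 w nB2).
- exact: box_integral_le n0 majj (hB3 w nB3).
- exact: (@box_sum_le R qh w ch K n n0 (hB4 w nB4)).
- exact: (@box_sum_le R qm w cm K n n0 (hB5 w nB5)).
rewrite lee_fin -/b0 -/X cmK.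
(* [X] depends on [w] but not on [n], so large [n] suffices, with no uniformity in [w]. *)
suff : X / n%:R <= delta / 2 by lra.
rewrite ler_pdivrMr// mulrC -ler_pdivrMr ?divr_gt0//.
by near: n; exact: nbhs_infty_ger.
Unshelve. all: by end_near. Qed.

End conclusion.

Theorem proposition3p2 (R : realType) (P : probability (Omega R) R)
    (Phi0 : Omega R -> int -> R)
    (P_measurable : jointly_measurable P)
    (P_stationary : stationary P)
    (P_ergodic : ergodic P)
    (P_moments : finite_moments P)
    (Phi0_corrector : is_corrector_field P Phi0) :
  {ae P, forall w,
    ((n%:R ^+ 2)^-1%:E *
       \int[leb R]_(t in `[0%R, (n%:R ^+ 2)%R])
         (((size (box n))%:R)^-1 *
            \sum_(x <- box n) `|n%:R^-1 * corrector Phi0 w t x|)%:E)%E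
      @[n --> \oo] --> (0%E : \bar R)}.
Proof.
(* For fixed [k] the failure event has outer probability at most [eta] for every [eta], hence is
   null; countably many [k] then give the limit. *)
have small (k : nat) : {ae P, forall w,
    \forall n \near \oo, (mean_corrector Phi0 n w <= k.+1%:R^-1%:E)%E}.
  apply: negligible_small => eta eta0.
  have k0 : 0 < k.+1%:R^-1 :> R by rewrite invr_gt0.
  have [B [mB PB [Z [mZ Z0 hZ]]]] := mean_corrector_small P_measurable P_stationary P_moments
    Phi0_corrector k0 eta0.
  exists (B `|` Z); split.
  - exact: measurableU.
  - by rewrite (le_trans (measureU2 _ _ _))//= Z0 adde0.
  - move=> w /= hw; have [|nB] := pselect (B w); first by left.
    by right; apply: hZ => /= /(_ nB).
apply: ae_mono (ae_forall_countable small) _ => w hw.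
apply: ge0_cvg0 hw => n; apply: mule_ge0; first by rewrite lee_fin invr_ge0 exprn_ge0.
by apply: integral_ge0 => t _; rewrite lee_fin mulr_ge0 ?invr_ge0// sumr_ge0.
Qed.
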